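(* For every $n\ge d\ge 2$, the multiplex $M^{d,n}$ is an elementary polytope.
   Context: A $d$-dimensional multiplex is a $d$-dimensional convex polytope with an ordered list of vertices $x_0,x_1,\ldots,x_n$ whose facets are $F_0,F_1,\ldots,F_n$, given by $F_i=\mathrm{conv}\{x_{i-d+1},x_{i-d+2},\ldots,x_{i-1},x_{i+1},x_{i+2},\ldots,x_{i+d-1}\}$, with the conventions that $x_j=x_0$ if $j<0$ and $x_j=x_n$ if $j>n$. For all $n\ge d\ge 2$ such a polytope exists (a known result of Bisztriczky); $M^{d,n}$ denotes the $d$-dimensional multiplex with $n+1$ vertices. The toric $h$-vector (as defined by Stanley) of a $d$-dimensional polytope $P$ is the vector $h(P)=(h_0,h_1,\ldots,h_d)$ of length $d+1$ formed by the coefficients of the polynomial $h(P,x)=\sum_{i=0}^d h_ix^i=\sum_F g(F,x)(x-1)^{d-1-\dim F}$, where the sum is over all faces $F\ne P$ of $P$, including the empty face (of dimension $-1$). Here $g(\emptyset,x)=1$, and for a nonempty face $F$ of dimension $e$ with $h(F,x)=\sum_{i=0}^e h_i(F)x^i$, one sets $g(F,x)=h_0(F)+\sum_{i=1}^{\lfloor e/2\rfloor}(h_i(F)-h_{i-1}(F))x^i$. The components of the toric $h$-vector are linear functions of the flag vector of $P$. A $d$-dimensional polytope $P$ is elementary if and only if the second and third entries in its toric $h$-vector are equal, i.e. $h_1=h_2$. In terms of the flag vector, this says $$f_{02}(P)-3f_2(P)+f_1(P)-d\,f_0(P)+\binom{d+1}{2}=0,$$ where $f_i(P)$ is the number of $i$-dimensional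 faces of $P$ and $f_{02}(P)$ is the number of pairs consisting of a vertex of $P$ and a $2$-dimensional face of $P$ containing it.
   Formalization: For d = 2 the two given forms of ''elementary'' disagree (a square, M^{2,3}, has toric h-vector (1,2,1) yet satisfies the flag-vector relation); here elementary means the flag-vector relation for d = 2, and both that relation and h_1 = h_2 for d ≥ 3. *)

(* Defs.v *)
From HB Require Import structures.
From mathcomp Require Import all_boot all_order all_algebra.
From mathcomp Require Import finmap.
From mathcomp Require Import boolp classical_sets functions cardinality fsbigop.
From mathcomp Require Import reals.

Set Implicit Arguments.
Unset Strict Implicit.
Unset Printing Implicit Defensive.

Import Order.TTheory GRing.Theory Num.Theory.

Local Open Scope classical_set_scope.
Local Open Scope ring_scope.

Section Polytopes.
Context {R : realType} {m : nat}.
Local Notation pt := 'rV[R]_m.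
Implicit Types (A P F : set pt) (a v : pt).

Definition conv A : set pt :=
  [set p | exists k (q : 'I_k -> pt) (c : 'I_k -> R),
    [/\ forall i, A (q i), forall i, 0 <= c i, \sum_i c i = 1
      & p = \sum_i c i *: q i]].

Definition polytope P : Prop := exists2 V : set pt, finite_set V & P = conv V.

Definition aff_indep k (p : 'I_k -> pt) : Prop :=
  forall c : 'I_k -> R,
    \sum_i c i = 0 -> \sum_i c i *: p i = 0 -> forall i, c i = 0.

(* The affine dimension plus one, so that it is a natural number also for the
   empty set (of dimension -1).  At most m + 1 points of R^m are affinely
   independent. *)
Definition rk A : nat :=
  \max_(k < m.+2 | `[< exists2 p : 'I_k -> pt,
                         aff_indep p & forall i, A (p i) >]) k.

Definition dot a v : R := \sum_i a 0 i * v 0 i.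

(* Taking a = 0 makes P itself and the empty set faces of P. *)
Definition face P F : Prop :=
  exists a (b : R), (forall v, P v -> dot a v <= b) /\
    F = P `&` [set v | dot a v = b].

Definition proper_faces P : set (set pt) := [set F | face P F /\ F <> P].

Definition faces_of_dim (i : nat) P : set (set pt) :=
  [set F | face P F /\ rk F = i.+1].

Definition vertices P : set pt := [set v | face P [set v]].

Definition facets P : set (set pt) := [set F | face P F /\ (rk F).+1 = rk P].

Definition toric_h_of (g : set pt -> {poly int}) P : {poly int} :=
  \sum_(F \in proper_faces P) g F * ('X - 1) ^+ ((rk P).-1 - rk F).

Definition toric_g_of_h (e : nat) (h : {poly int}) : {poly int} :=
  (h`_0)%:P + \sum_(1 <= i < e./2.+1) (h`_i - h`_(i.-1)) *: 'X^i.

(* The first argument only serves to make the recursion structural: proper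
   faces have smaller rank, so any value at least rk F gives g(F, x); see
   toric_gE. *)
Fixpoint toric_g_rec (fuel : nat) F : {poly int} :=
  if fuel is fuel'.+1 then
    if rk F == 0%N then 1
    else toric_g_of_h (rk F).-1 (toric_h_of (toric_g_rec fuel') F)
  else 1.

Definition toric_g F : {poly int} := toric_g_rec (rk F) F.

Definition toric_h P : {poly int} := toric_h_of toric_g P.

Lemma aff_indep_le k (p : 'I_k -> pt) : aff_indep p -> (k <= m.+1)%N.
Proof.
move=> pi; pose A : 'M[R]_(k, 1 + m) := \matrix_i row_mx (1%:M) (p i).
suff /eqP <- : row_free A by exact: rank_leq_col.
apply/inj_row_free => u uA0.
have uE : u *m A = row_mx (\sum_i u 0 i)%:M (\sum_i u 0 i *: p i).
  rewrite mulmx_sum_row.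
  rewrite (eq_bigr (fun i => row_mx (u 0 i)%:M (u 0 i *: p i))); last first.
    by move=> i _; rewrite rowK scale_row_mx scale_scalar_mx mulr1.
  apply: (big_rec3 (fun x y z => x = row_mx y%:M z)).
    by rewrite raddf0 row_mx0.
  by move=> i x y z _ ->; rewrite add_row_mx raddfD.
move: uA0; rewrite uE -(@row_mx0 R 1 1 m) => /eq_row_mx[u0 up0].
have {}u0 : \sum_i u 0 i = 0.
  by move/matrixP/(_ 0 0): u0; rewrite !mxE eqxx mulr1n.
by apply/rowP => i; rewrite mxE; exact: pi u0 up0 i.
Qed.

Lemma rk_ge k (p : 'I_k -> pt) A :
  aff_indep p -> (forall i, A (p i)) -> (k <= rk A)%N.
Proof.
move=> pi pA; have km : (k < m.+2)%N by rewrite ltnS (aff_indep_le pi).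
rewrite /rk; apply: (@leq_bigmax_cond _ _ _ (Ordinal km)).
by apply/asboolP; exists p.
Qed.

Lemma rk_attained A :
  exists2 p : 'I_(rk A) -> pt, aff_indep p & forall i, A (p i).
Proof.
rewrite /rk; set Q := (X in \max_(k < _ | X k) _).
have Q0 : Q ord0.
  by apply/asboolP; exists (fun=> 0) => [c _ _ []|[]].
have [k Qk ->] : {k : 'I_m.+2 | Q k & \max_(k < m.+2 | Q k) k = k :> nat}.
  by apply: eq_bigmax_cond; apply/card_gt0P; exists ord0.
by have /asboolP := Qk.
Qed.

Lemma dot_sumZ k (c : 'I_k -> R) (p : 'I_k -> pt) a :
  dot a (\sum_i c i *: p i) = \sum_i c i * dot a (p i).
Proof.
rewrite /dot; under [RHS]eq_bigr do rewrite mulr_sumr.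
rewrite exchange_big; apply: eq_bigr => j _.
rewrite summxE mulr_sumr; apply: eq_bigr => i _.
by rewrite !mxE mulrCA.
Qed.

Lemma rk_face P F : face P F -> F <> P -> (rk F < rk P)%N.
Proof.
move=> [a [b [Pb FE]]] FP.
have [v Pv vb] : exists2 v, P v & dot a v <> b.
  apply: contra_notP FP => /forall2NP h; rewrite FE.
  apply/seteqP; split=> [v []//|v Pv]; split=> //.
  by case: (h v) => // /contrapT.
have [p pi pF] := rk_attained F.
pose q (i : 'I_(rk F).+1) := if unlift ord0 i is Some j then p j else v.
apply: (@rk_ge _ q) => [c c0 cq0|i].
  have q0 : q ord0 = v by rewrite /q unlift_none.
  have qS j : q (lift ord0 j) = p j by rewrite /q liftK.
  have cv : c ord0 = 0.
    have : \sum_i c i * dot a (q i) = 0.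
      by rewrite -dot_sumZ cq0 /dot big1 // => j _; rewrite mxE mulr0.
    rewrite big_ord_recl q0 (eq_bigr (fun j => c (lift ord0 j) * b)); last first.
      by move=> j _; rewrite qS; have := pF j; rewrite {1}FE => -[_ /= ->].
    rewrite -mulr_suml; move: c0; rewrite big_ord_recl => /eqP.
    rewrite addrC addr_eq0 => /eqP ->.
    rewrite mulNr -mulrBr => /eqP; rewrite mulf_eq0 subr_eq0.
    by case/orP=> /eqP.
  have cS j : c (lift ord0 j) = 0.
    apply: (pi (fun j => c (lift ord0 j))).
      by move: c0; rewrite big_ord_recl cv add0r.
    move: cq0; rewrite big_ord_recl cv scale0r add0r.
    by under eq_bigr do rewrite qS.
  by move=> i; case: (unliftP ord0 i) => [j ->|->].
rewrite /q; case: unliftP => [j _|_] //.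
by have := pF j; rewrite {1}FE => -[].
Qed.

Lemma toric_gE F :
  toric_g F =
    if rk F == 0%N then 1 else toric_g_of_h (rk F).-1 (toric_h F).
Proof.
have stable k : forall l G, (rk G <= k)%N -> (rk G <= l)%N ->
    toric_g_rec k G = toric_g_rec l G.
  elim: k => [|k IH] [|l] G //=; rewrite ?leqn0.
  - by move=> ->.
  - by move=> _ ->.
  move=> Gk Gl; case: ifP => // _; congr toric_g_of_h.
  apply: eq_fsbigr => H /set_mem[GH HG]; congr (_ * _).
  have HlG := rk_face GH HG.
  by apply: IH; rewrite -ltnS (leq_trans HlG).
rewrite /toric_g; case E : (rk F) => [|k] //=; rewrite E /=.
congr toric_g_of_h; apply: eq_fsbigr => H /set_mem[FH HF]; congr (_ * _).
by apply: stable => //; rewrite -ltnS -E; exact: rk_face.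
Qed.

Definition fnum (i : nat) P : nat := #|` fset_set (faces_of_dim i P)|.

Definition fnum02 P : nat :=
  #|` fset_set [set vF : pt * set pt |
       [/\ vertices P vF.1, faces_of_dim 2 P vF.2 & vF.2 vF.1]]|.

Definition flag_relation P : Prop :=
  let d := (rk P).-1 in
  (fnum02 P)%:Z - 3 * (fnum 2 P)%:Z + (fnum 1 P)%:Z - d%:Z * (fnum 0 P)%:Z
    + ('C(d.+1, 2))%:Z = 0.

(* In dimension at least 3 the condition h_1 = h_2 and the flag-vector relation
   say the same thing.  A polygon with v vertices has toric h-vector
   (1, v - 2, 1) and satisfies the flag-vector relation for every v (it is
   itself counted as its only 2-face), whereas h_1 = h_2 only holds for v = 3;
   in dimension 2 being elementary is therefore read as the flag-vector
   relation alone. *)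
Definition elementary P : Prop :=
  ((2 < (rk P).-1)%N -> (toric_h P)`_1 = (toric_h P)`_2) /\ flag_relation P.

(* The convention x_j = x_0 for j < 0 and x_j = x_n for j > n. *)
Definition clamp n (j : int) : 'I_n.+1 :=
  if j is Posz k then inord (minn k n) else ord0.

Definition multiplex_facet d n (x : 'I_n.+1 -> pt) (i : 'I_n.+1) : set pt :=
  conv [set x (clamp n j) | j in
    [set j : int | (i%:Z - d%:Z + 1 <= j <= i%:Z + d%:Z - 1) && (j != i%:Z)]].

Definition multiplex d n (x : 'I_n.+1 -> pt) P : Prop :=
  [/\ polytope P, rk P = d.+1, injective x, vertices P = range x
    & facets P = range (multiplex_facet d x)].

End Polytopes.

(* Main.v *)
Require Import Defs.
From mathcomp Require Import all_boot all_order all_algebra.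
From mathcomp Require Import finmap boolp classical_sets cardinality.
From mathcomp Require Import fsbigop reals.
From mathcomp Require Import fintype finset.
From mathcomp Require Import zify ring lra.

(* The simplices conv {x_p, ..., x_(p+d)} triangulate the multiplex, and this
   triangulation is shallow: let Delta be the complex of all sets of vertices
   of diameter at most d.  Every s in Delta has a carrier, the smallest face
   containing it, and a face of dimension r - 1 with r + g vertices (g >= 0)
   carries g + 1 elements of size r of Delta and g elements of size r - 1.
   Summing y^(-|s|) over the s in Delta contained in a given face in two ways
   (by carriers, and by adding the vertices of the face one at a time) gives,
   with x = y + 1,
     sum_(K <= J) (1 + g(K) x) (x - 1)^(r(J) - r(K)) = x^r(J) + g(J) x^(r(J)-1).
   By induction this says that g(J, x) = 1 + g(J) x for every face J, hence
   h_1 = h_2; its coefficient of degree d - 1 in y is the flag-vector relation.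
   The faces are the intersections of facets, and their dimensions are
   determined by exhibiting chains of faces of maximal length. *)

Set Implicit Arguments.
Unset Strict Implicit.
Unset Printing Implicit Defensive.

Import Order.TTheory GRing.Theory Num.Theory.

(** * The face lattice of a multiplex *)

Section MultiplexLattice.
Context (d n : nat) (d2 : (2 <= d)%N) (dn : (d <= n)%N).
Local Notation V := 'I_n.+1.
Implicit Types (i j k p q : V) (I J K : {set V}).

Definition inner i : bool := (0 < i < n)%N.

(* Because of the convention x_j = x_0 for j < 0 and x_j = x_n for j > n, the
   extreme vertices x_0 and x_n belong to their own facets F_0 and F_n. *)
Definition facet_set i : {set V} :=
  [set j : V | [&& i < j + d, j < i + d & (j != i) || ~~ inner i]%N].

Definition facets_above K : {set V} := [set i | K \subset facet_set i].

Definition facet_cap I : {set V} := \bigcap_(i in I) facet_set i.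

(** The closed sets of the Galois connection between vertex sets and facet index sets;
    [exposed_flat] identifies them with the vertex sets of faces. *)
Definition flat K : bool := facet_cap (facets_above K) == K.

Lemma flatE K : flat K = (facet_cap (facets_above K) == K).
Proof. by []. Qed.

Definition diam_le e K : bool :=
  [forall i in K, forall j in K, j <= i + e]%N.

(** By [flat_cases] and [cap_not_simp], the flats that fail [simp] are exactly the intersections of
    facets over such index sets. *)
Definition short I : bool := [forall i in I, inner i] && diam_le (d - 2) I.

(** Simplices all of whose subsets are flats. The bound is relaxed by one at the ends because x_0
    and x_n lie on their own facets. A flat that fails it may still be a simplex, as the whole
    polytope does for n = d. *)
Definition simp K : bool :=
  diam_le (d - 2) K || diam_le (d - 1) K && ((ord0 \in K) || (ord_max \in K)).

Lemma diam_leP e K :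
  reflect (forall i j, i \in K -> j \in K -> (j <= i + e)%N) (diam_le e K).
Proof.
apply: (iffP forall_inP) => [h i j iK jK|h i iK].
  by have /forall_inP := h i iK; exact.
by apply/forall_inP => j jK; exact: h.
Qed.

Lemma diam_leS e J K : J \subset K -> diam_le e K -> diam_le e J.
Proof.
by move=> /subsetP JK /diam_leP h; apply/diam_leP => i j /JK iK /JK; exact: h.
Qed.

Lemma diam_leW e e' K : (e <= e')%N -> diam_le e K -> diam_le e' K.
Proof.
move=> ee' /diam_leP h; apply/diam_leP => i j iK jK.
by apply: leq_trans (h _ _ iK jK) _; rewrite leq_add2l.
Qed.

Lemma in_facet_cap I j : (j \in facet_cap I) = [forall i in I, j \in facet_set i].
Proof. by apply/bigcapP/forall_inP. Qed.

Lemma in_facets_above K i : (i \in facets_above K) = (K \subset facet_set i).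
Proof. by rewrite inE. Qed.

Lemma sub_facet_cap I K : (I \subset facets_above K) = (K \subset facet_cap I).
Proof.
apply/subsetP/bigcapsP => h i iI; first by rewrite -in_facets_above h.
by rewrite in_facets_above h.
Qed.

Lemma sub_capK K : K \subset facet_cap (facets_above K).
Proof. by rewrite -sub_facet_cap. Qed.

Lemma facet_capS I J : I \subset J -> facet_cap J \subset facet_cap I.
Proof. by move=> IJ; rewrite -sub_facet_cap (subset_trans IJ) // sub_facet_cap. Qed.

Lemma facets_aboveS J K : J \subset K -> facets_above K \subset facets_above J.
Proof. by move=> JK; rewrite sub_facet_cap (subset_trans JK) // sub_capK. Qed.

Lemma facets_aboveK K : facets_above (facet_cap (facets_above K)) = facets_above K.
Proof.
by apply/eqP; rewrite eqEsubset (facets_aboveS (sub_capK K)) sub_facet_cap subxx.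
Qed.

Lemma flat_cap I : flat (facet_cap I).
Proof.
by rewrite /flat eqEsubset sub_capK facet_capS // sub_facet_cap.
Qed.

Lemma shortP I : reflect
  (forall i, i \in I -> inner i /\ forall j, j \in I -> (j + 2 <= i + d)%N)
  (short I).
Proof.
apply: (iffP andP) => [[/forall_inP h /diam_leP h'] i iI|h].
  by split=> [|j jI]; [exact: h|have := h' i j iI jI; lia].
split; first by apply/forall_inP => i /h[].
by apply/diam_leP => i j /h[_ h'] /h'; lia.
Qed.

Lemma short_in_facet_cap I j : short I ->
  (j \in facet_cap I) = (j \notin I) && [forall i in I, (i < j + d) && (j < i + d)]%N.
Proof.
move=> /shortP sI; rewrite in_facet_cap.
apply/forall_inP/andP => [h|[jI /forall_inP h] i iI].
  split.
    apply/negP => jI; have := h j jI; rewrite inE eqxx.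
    by have [-> _] := sI j jI; rewrite !andbF.
  by apply/forall_inP => i /h; rewrite inE => /and3P[-> ->].
rewrite inE andbA h //=; apply/orP; left.
by apply: contraNneq jI => ->.
Qed.

(** Only the least and the greatest index in I limit how far a vertex of the face may lie. The
    numbers from p0 to p1 are the starts p of the windows [p, p + d] that hold I strictly inside;
    these windows without I are the top simplices of the face. *)
Lemma short_interval I : short I -> exists p0 p1 : nat,
  [/\ (p0 <= p1)%N, (p1 + d <= n)%N, forall i, i \in I -> (p1 < i < p0 + d)%N,
      (forall p : nat, (p + d <= n)%N ->
        (forall i, i \in I -> (p < i < p + d)%N) -> (p0 <= p <= p1)%N)
    & forall j, (j \in facet_cap I) = (p0 <= j <= p1 + d)%N && (j \notin I)].
Proof.
move=> sI; have /shortP sI' := sI.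
have [->|[i0 i0I]] := set_0Vmem I.
  exists 0%N, (n - d)%N; split=> [||i|p pd _|j]; rewrite ?inE //; try lia.
  rewrite in_facet_cap; have -> : [forall i in set0, j \in facet_set i].
    by apply/forall_inP => i; rewrite inE.
  by have := ltn_ord j; lia.
pose a := [arg min_(i < i0 in I) (i : nat)].
pose b := [arg max_(i > i0 in I) (i : nat)].
have [aI amin] : a \in I /\ forall i, i \in I -> (a <= i)%N.
  by rewrite /a; case: arg_minnP.
have [bI bmax] : b \in I /\ forall i, i \in I -> (i <= b)%N.
  by rewrite /b; case: arg_maxnP.
have [/andP[a0 an] ab] := sI' a aI; have [/andP[b0 bn] _] := sI' b bI.
have {}ab := ab b bI.
(* Truncated subtraction keeps p0 nonnegative, and [minn] keeps the last window inside [0, n]. *)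
exists (b.+1 - d)%N, (minn a.-1 (n - d)); split=> [||i iI|p pd h|j].
- lia.
- lia.
- by have := amin i iI; have := bmax i iI; lia.
- by have := h a aI; have := h b bI; lia.
rewrite (short_in_facet_cap _ sI) andbC; congr (_ && _).
apply/forall_inP/idP => [h|h i iI].
  by have := h a aI; have := h b bI; have := ltn_ord j; lia.
by have := amin i iI; have := bmax i iI; lia.
Qed.

(** A set failing [simp] contains p and q with q >= p + d, or with q = p + d - 1 and both inner. A
    facet through x_p and x_q has its index i strictly between p and q and with q - d < i < p + d,
    so these indices form a short set. *)
Lemma flat_cases K : flat K -> simp K \/ exists2 I, short I & K = facet_cap I.
Proof.
move=> /eqP cK; case: (boolP (simp K)) => [|sK]; [by left | right].
exists (facets_above K); last by rewrite cK.
have omP i : i \in facets_above K -> forall j, j \in K ->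
    [&& i < j + d, j < i + d & (j != i) || ~~ inner i]%N.
  by rewrite in_facets_above => /subsetP h j /h; rewrite inE.
have [p [q [pK qK pq]]] : exists p q, [/\ p \in K, q \in K & (p + d - 1 <= q)%N
    /\ ((p + d <= q)%N \/ inner p /\ inner q)].
  move: sK; rewrite negb_or negb_and negb_or => /andP[+ /orP[|/andP[K0 Kn]]].
  - move=> _ /forall_inPn[p pK] /forall_inPn[q qK] pq.
    by exists p, q; split=> //; lia.
  - move=> /forall_inPn[p pK] /forall_inPn[q qK] pq.
    exists p, q; split=> //; split; first by lia.
    right; rewrite /inner.
    have : p != ord0 by apply: contraNneq K0 => <-.
    have : q != ord_max by apply: contraNneq Kn => <-.
    rewrite -!val_eqE /=; have := ltn_ord q; have := ltn_ord p; lia.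
have pqn i : i \in facets_above K -> inner i /\ (q - d < i < p + d)%N /\
    ((p + d <= q)%N || (i != p) && (i != q)).
  move=> iK; have := omP i iK p pK; have := omP i iK q qK.
  rewrite /inner in pq *; rewrite -!val_eqE /=; have := ltn_ord q.
  have := ltn_ord p; lia.
apply/shortP => i iK; have [ii [ipq ie]] := pqn i iK; split=> // j jK.
have [_ [jpq je]] := pqn j jK.
move: ie je; rewrite -!val_eqE /=; lia.
Qed.

(** For each j outside K some facet contains K and misses x_j. Which one depends on whether j is at
    distance at least d from K on one side, and otherwise on whether j is inner. *)
Lemma simp_flat K : simp K -> flat K.
Proof.
move=> sK; rewrite /flat eqEsubset sub_capK andbT.
apply/subsetP => j; apply: contraTT => jK.
suff [i iK ij] : exists2 i, i \in facets_above K & j \notin facet_set i.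
  by rewrite in_facet_cap; apply/forall_inPn; exists i.
have d1 : diam_le (d - 1) K.
  by case/orP: sK => [|/andP[]//]; apply: diam_leW; lia.
have d2' : ord0 \notin K -> ord_max \notin K -> diam_le (d - 2) K.
  by move=> /negPf K0 /negPf Kn; move: sK; rewrite /simp K0 Kn andbF orbF.
have K0 k : k \in K -> ord0 \notin K -> (0 < k)%N.
  move=> kK; apply: contraR; rewrite -eqn0Ngt => k0.
  by rewrite (_ : ord0 = k) //; apply/val_inj/esym/eqP.
have Kn k : k \in K -> ord_max \notin K -> (k < n)%N.
  move=> kK; apply: contraR => k0.
  rewrite (_ : ord_max = k) //; apply/val_inj => /=.
  by have := ltn_ord k; lia.
have omI i : (forall k, k \in K ->
    [&& i < k + d, k < i + d & (k != i) || ~~ inner i]%N) -> i \in facets_above K.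
  by move=> h; rewrite in_facets_above; apply/subsetP => k /h; rewrite inE.
move/diam_leP in d1.
case: (boolP [exists k in K, (j + d <= k)%N]) => [/exists_inP[k kK jk]|far].
  case: (boolP (ord_max \in K)) => [nK|nK].
    exists ord_max; last by rewrite inE /=; have := ltn_ord k; lia.
    apply: omI => l lK; rewrite /inner /= ltnn andbF orbT.
    by have := d1 _ _ lK nK; rewrite /=; have := ltn_ord l; lia.
  have zK : ord0 \notin K.
    by apply/negP => zK; have := d1 _ _ zK kK; rewrite /=; lia.
  have /diam_leP {}d2' := d2' zK nK.
  pose q := [arg max_(i > k in K) (i : nat)].
  have [qK qmax] : q \in K /\ forall i, i \in K -> (i <= q)%N.
    by rewrite /q; case: arg_maxnP.
  have qn := ltn_ord q; have jkq := qmax k kK.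
  (* The facet just after the greatest index of K: it contains K since K has diameter at most d - 2,
     and it is too far from j. *)
  have iP : (q.+1 < n.+1)%N by have := Kn q qK nK; lia.
  exists (Ordinal iP); last by rewrite inE /=; lia.
  apply: omI => l lK; have := qmax l lK; have := d2' l q lK qK.
  rewrite -val_eqE /=; lia.
case: (boolP [exists k in K, (k + d <= j)%N]) => [/exists_inP[k kK jk]|far'].
  have jn := ltn_ord j.
  case: (boolP (ord0 \in K)) => [zK|zK].
    exists ord0; last by rewrite inE /=; lia.
    apply: omI => l lK; rewrite /inner /= orbT.
    by have := d1 _ _ zK lK; rewrite /=; lia.
  have nK : ord_max \notin K.
    by apply/negP => nK; have := d1 _ _ kK nK; rewrite /=; lia.
  have /diam_leP {}d2' := d2' zK nK.
  pose p := [arg min_(i < k in K) (i : nat)].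
  have [pK pmin] : p \in K /\ forall i, i \in K -> (p <= i)%N.
    by rewrite /p; case: arg_minnP.
  have jkp := pmin k kK.
  have p0 := K0 p pK zK.
  have iP : (p.-1 < n.+1)%N by have := ltn_ord p; lia.
  exists (Ordinal iP); last by rewrite inE /=; lia.
  apply: omI => l lK; have := pmin l lK; have := d2' p l pK lK.
  rewrite -val_eqE /=; lia.
have {far far'} jnear k : k \in K -> (k < j + d)%N /\ (j < k + d)%N.
  move=> kK; split.
    by move/exists_inPn: far => /(_ k kK); rewrite -ltnNge.
  by move/exists_inPn: far' => /(_ k kK); rewrite -ltnNge.
case: (boolP (inner j)) => jin.
  exists j; last by rewrite inE eqxx jin /= !andbF.
  apply: omI => k kK; have [-> ->] := jnear k kK; rewrite /=.
  by rewrite (_ : k != j) //; apply: contraNneq jK => <-.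
have /orP[/eqP j0|/eqP jn] : (j == ord0) || (j == ord_max).
  by move: jin; rewrite /inner -!val_eqE /=; have := ltn_ord j; lia.
  (* For j = 0 the facet is F_d: all indices in K are positive and below d. The case j = n is the
     mirror image. *)
  have iP : (d < n.+1)%N by lia.
  exists (Ordinal iP); last by rewrite inE j0 /=; lia.
  apply: omI => k kK; have := jnear k kK; have := K0 k kK.
  rewrite -j0 => /(_ jK); rewrite -val_eqE j0 /=; lia.
have iP : (n - d < n.+1)%N by lia.
exists (Ordinal iP); last by rewrite inE jn /=; lia.
apply: omI => k kK; have := jnear k kK; have := Kn k kK.
rewrite -jn => /(_ jK); rewrite -val_eqE jn /=; lia.
Qed.

(** Within diameter d - 1 of x_0, deleting x_0 leaves indices from 1 to d - 1, of diameter at most d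
    - 2; likewise for x_n. *)
Lemma simpS J K : J \subset K -> simp K -> simp J.
Proof.
move=> JK /orP[h|/andP[h h0]]; apply/orP; first by left; exact: diam_leS h.
have hJ := diam_leS JK h; rewrite hJ /=.
case: (boolP (ord0 \in J)) => J0; first by right.
case: (boolP (ord_max \in J)) => Jn; first by right.
left; apply/diam_leP => i j iJ jJ.
have iK := subsetP JK i iJ; have jK := subsetP JK j jJ.
have i0 : (i : nat) != 0%N.
  by apply: contraNneq J0 => i0; rewrite (_ : ord0 = i) //; exact: val_inj.
have jn : (j : nat) != n.
  by apply: contraNneq Jn => jn; rewrite (_ : ord_max = j) //; exact: val_inj.
move/diam_leP in h; case/orP: h0 => [h0|hn].
  by have := h _ _ h0 jK; rewrite /=; lia.
by have := h _ _ iK hn; rewrite /=; have := ltn_ord j; lia.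
Qed.

(* facet_cap I contains x_p and x_(p+d) for some p, and every vertex strictly
   between these two that is not indexed by I. *)
Lemma facets_above_cap I : short I -> facets_above (facet_cap I) = I.
Proof.
move=> sI; apply/eqP; rewrite eqEsubset [X in _ && X]sub_facet_cap subxx andbT.
have [p0 [p1 [p01 p1n Ip _ capE]]] := short_interval sI.
have oP (p : nat) : (p <= n)%N -> exists i, i = p :> nat.
  by move=> pn; exists (inord p); rewrite inordK.
have [i0 i0E] := oP p0 ltac:(lia); have [i1 i1E] := oP (p0 + d)%N ltac:(lia).
have i0s : i0 \in facet_cap I.
  by rewrite capE; apply/andP; split; [lia|apply/negP => /Ip; lia].
have i1s : i1 \in facet_cap I.
  by rewrite capE; apply/andP; split; [lia|apply/negP => /Ip; lia].
apply/subsetP => i; rewrite in_facets_above => /subsetP h; apply: contraT => iI.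
have := h _ i0s; have := h _ i1s; rewrite !inE -!val_eqE /= => hi1 hi0.
have : i \in facet_cap I by rewrite capE iI; lia.
move=> /h; rewrite inE eqxx /inner; lia.
Qed.

(** The vertices with indices p0 and p0 + d both survive in the intersection. *)
Lemma cap_diam I : short I -> ~~ diam_le (d - 1) (facet_cap I).
Proof.
move=> sI.
have [p0 [p1 [p01 p1n Ip _ capE]]] := short_interval sI.
have oP (p : nat) : (p <= n)%N -> exists i, i = p :> nat.
  by move=> pn; exists (inord p); rewrite inordK.
have [i0 i0E] := oP p0 ltac:(lia); have [i1 i1E] := oP (p0 + d)%N ltac:(lia).
apply/forall_inPn; exists i0.
  by rewrite capE; apply/andP; split; [lia|apply/negP => /Ip; lia].
apply/forall_inPn; exists i1; last by lia.
by rewrite capE; apply/andP; split; [lia|apply/negP => /Ip; lia].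
Qed.

Lemma simp_diam K : simp K -> diam_le (d - 1) K.
Proof. by case/orP => [|/andP[]//]; apply: diam_leW; lia. Qed.

Lemma cap_not_simp I : short I -> simp (facet_cap I) = false.
Proof.
by move=> sI; apply: contraNF (cap_diam sI) => /simp_diam.
Qed.

(* A face facet_cap I has dimension d - #|I|: its facets_above are exactly I. *)
Definition rank K : nat := if simp K then #|K| else d.+1 - #|facets_above K|.

Lemma rank_simp K : simp K -> rank K = #|K|.
Proof. by rewrite /rank => ->. Qed.

Lemma rank_cap I : short I -> rank (facet_cap I) = (d.+1 - #|I|)%N.
Proof. by move=> sI; rewrite /rank cap_not_simp ?facets_above_cap. Qed.

End MultiplexLattice.

(** The binomial theorem, with the subsets grouped by cardinality. *)
Lemma sum_subsets (T : finType) (A : comNzRingType) (y : A) (B : {set T}) m :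
  (#|B| <= m)%N ->
  (\sum_(s : {set T} | s \subset B) y ^+ (m - #|s|) =
   y ^+ (m - #|B|) * (y + 1) ^+ #|B|)%R.
Proof.
move=> Bm; rewrite exprDn mulr_sumr.
rewrite (partition_big (fun s : {set T} => inord #|s| : 'I_#|B|.+1) xpredT) //=.
apply: eq_bigr => k _; rewrite expr1n mulr1 mulrnAr -exprD.
rewrite (eq_bigl (fun s : {set T} => (s \subset B) && (#|s| == k :> nat))); last first.
  move=> s; have [sB|//] := boolP (s \subset B).
  by rewrite /= -val_eqE /= inordK // ltnS subset_leq_card.
rewrite (eq_bigr (fun=> y ^+ (m - #|B| + (#|B| - k)))%R); last first.
  by move=> s /andP[_ /eqP ->]; congr (_ ^+ _)%R; have := ltn_ord k; lia.
by rewrite sumr_const -cards_draws cardsE.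
Qed.

(** * The shallow triangulation *)

Section Triangulation.
Context (d n : nat) (d2 : (2 <= d)%N) (dn : (d <= n)%N).
Local Notation V := 'I_n.+1.
Implicit Types (i j k : V) (I J K s : {set V}).

Local Notation facets_above := (facets_above d).
Local Notation facet_cap := (@facet_cap d n).
Local Notation flat := (flat d).
Local Notation simp := (simp d).
Local Notation short := (short d).
Local Notation rank := (rank d).

Definition segment (p q : nat) : {set V} := [set j : V | p <= j <= q]%N.

Lemma card_segment (p q : nat) : (q <= n)%N -> #|segment p q| = (q.+1 - p)%N.
Proof.
move=> qn; rewrite -sum1dep_card.
rewrite -(big_mkord (fun j : nat => p <= j <= q)%N (fun=> 1%N)).
rewrite -[RHS]muln1 -sum_nat_const_nat.
rewrite [RHS](@big_nat_widen _ _ _ _ _ n.+1) //.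
rewrite [RHS](@big_nat_widenl _ _ _ _ 0%N) //.
by apply: eq_bigl => j; rewrite /= ltnS andbC.
Qed.

Lemma card_segmentD (p q : nat) I : (q <= n)%N ->
  (forall i, i \in I -> (p <= i <= q)%N) ->
  #|segment p q :\: I| = (q.+1 - p - #|I|)%N.
Proof.
move=> qn Ipq; rewrite cardsD card_segment // (setIidPr _) //.
by apply/subsetP => i /Ipq; rewrite inE.
Qed.

Lemma short_card I : short I -> (#|I| < d)%N.
Proof.
move=> sI; have [p0 [p1 [p01 p1n Ip _ _]]] := short_interval d2 dn sI.
have /subset_leq_card : I \subset segment p1.+1 (p0 + d - 1).
  by apply/subsetP => i /Ip; rewrite inE; lia.
by rewrite card_segment //; lia.
Qed.

Lemma card_cap I (p0 p1 : nat) :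
    (p0 <= p1)%N -> (p1 + d <= n)%N ->
    (forall i, i \in I -> p1 < i < p0 + d)%N ->
    (forall j, (j \in facet_cap I) = (p0 <= j <= p1 + d)%N && (j \notin I)) ->
  facet_cap I = segment p0 (p1 + d) :\: I /\
  #|facet_cap I| = (p1 + d.+1 - p0 - #|I|)%N.
Proof.
move=> p01 p1n Ip capE.
have E : facet_cap I = segment p0 (p1 + d) :\: I.
  by apply/setP => j; rewrite capE !inE andbC.
split=> //; rewrite E card_segmentD //; first by lia.
by move=> i /Ip; lia.
Qed.

(** In the non-simplicial case s avoids I and fits in a window of d + 1 consecutive indices that
    contains I. *)
Lemma diam_cap_card s J :
  flat J -> diam_le d s -> s \subset J -> (#|s| <= rank J)%N.
Proof.
move=> fJ ds sJ; have [sJ'|[I sI JE]] := flat_cases d2 dn fJ.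
  by rewrite rank_simp // subset_leq_card.
have [p0 [p1 [p01 p1n Ip _ capE]]] := short_interval d2 dn sI.
have Id := short_card sI.
rewrite JE rank_cap //.
have [->|[i0 i0s]] := set_0Vmem s; first by rewrite cards0.
pose m := [arg min_(i < i0 in s) (i : nat)].
have [ms mmin] : m \in s /\ forall i, i \in s -> (m <= i)%N.
  by rewrite /m; case: arg_minnP.
move/diam_leP in ds.
(* The start is pulled back to at most p1 so that the window contains all of I. *)
have sub : s \subset segment (minn m p1) (minn m p1 + d) :\: I.
  apply/subsetP => j js; have := subsetP sJ j js; rewrite JE capE.
  rewrite !inE => /andP[jp ->]; have := mmin j js; have := ds m j ms js; lia.
apply: leq_trans (subset_leq_card sub) _.
have := subsetP sJ m ms; rewrite JE capE => /andP[mp _].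
by rewrite card_segmentD; [lia|lia|move=> i /Ip; lia].
Qed.

(** The sets s with carrier [facet_cap I] are the top simplices and the intersections of consecutive
    ones. Such an s fails [simp], so it spans d, or spans d - 1 without x_0 and x_n. If an index
    strictly inside the span is missing from s, its facet contains s, so the index is in I. *)
Lemma facets_above_fiber I (p0 p1 : nat) :
    short I -> (p0 <= p1)%N -> (p1 + d <= n)%N ->
    (forall i, i \in I -> p1 < i < p0 + d)%N ->
    (forall p : nat, (p + d <= n)%N ->
      (forall i, i \in I -> (p < i < p + d)%N) -> (p0 <= p <= p1)%N) ->
    (forall j, (j \in facet_cap I) = (p0 <= j <= p1 + d)%N && (j \notin I)) ->
  [set s | diam_le d s && (facets_above s == I)] =
    [set segment p (p + d) :\: I | p : V in segment p0 p1] :|: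
    [set segment p (p + (d - 1)) :\: I | p : V in segment p0.+1 p1].
Proof.
move=> sI p01 p1n Ip Imax capE.
pose S (e p : nat) := segment p (p + e) :\: I.
apply/setP => s; rewrite inE; apply/idP/idP.
  move=> /andP[/diam_leP ds /eqP omE].
  have omP i : (i \in I) = (s \subset facet_set d i) by rewrite -omE in_facets_above.
  have Is i j : i \in I -> j \in s -> (i < j + d)%N /\ (j < i + d)%N /\ j != i.
    move=> iI js; have [ii _] := shortP d2 dn I sI i iI.
    move: iI; rewrite omP => /subsetP /(_ j js).
    by rewrite inE ii orbF => /and3P[].
  have sS (p e : nat) : (forall j, j \in s -> (p <= j <= p + e)%N) ->
      (forall j, (p <= j <= p + e)%N -> (j = p :> nat) \/ (j = p + e :> nat)%N -> j \in s) ->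
      (d - 1 <= e <= d)%N -> s = S e p.
    move=> sp pe ed; apply/setP => j; rewrite !inE; apply/idP/andP => [js|[jI jp]].
      split; last exact: sp.
      by apply/negP => jI; have [_ [_]] := Is j j jI js; rewrite eqxx.
    apply: contraR jI => js; rewrite omP; apply/subsetP => k ks.
    have jk : k != j by apply: contraNneq js => <-.
    rewrite inE jk andbT; have := sp k ks.
    have : (j : nat) != p by apply: contraNneq js => jp'; apply: pe => //; left.
    have : (j : nat) != (p + e)%N.
      by apply: contraNneq js => jp'; apply: pe => //; right.
    move: jk; rewrite -val_eqE /=; lia.
  have ns : ~~ simp s.
    apply/negP => ss; have /eqP := simp_flat d2 dn ss.
    by rewrite omE => sE; move: ss; rewrite -sE cap_not_simp.
  move: ns; rewrite negb_or negb_and negb_or => /andP[dd].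
  have [/diam_leP ds1|/forall_inPn[p ps] /forall_inPn[q qs] pq _] := boolP (diam_le (d - 1) s).
    move=> /= /andP[s0 sn]; rewrite inE; apply/orP; right.
    have [p [q [ps qs pq]]] : exists p q, [/\ p \in s, q \in s & (p + (d - 1) <= q)%N].
      move/forall_inPn: dd => [p ps] /forall_inPn[q qs] pq.
      by exists p, q; split=> //; lia.
    have pqE : (q : nat) = (p + (d - 1))%N by have := ds1 p q ps qs; lia.
    have p_gt0 : (0 < p)%N.
      by rewrite lt0n; apply: contraNneq s0 => p0'; rewrite (_ : ord0 = p) //; exact: val_inj.
    have q_ltn : (q < n)%N.
      rewrite ltn_neqAle -ltnS ltn_ord andbT.
      by apply: contraNneq sn => p0'; rewrite (_ : ord_max = q) //; exact: val_inj.
    apply/imsetP; exists p.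
      have Ipq i : i \in I -> (p < i < q)%N.
        move=> iI; have := Is i p iI ps; have := Is i q iI qs.
        by rewrite -!val_eqE /=; lia.
      (* Both windows [p - 1, q] and [p, q + 1] lie in [0, n] and hold I strictly inside, so both
         starts are admissible. *)
      have h1 : (p0 <= p.-1 <= p1)%N by apply: Imax => [|i /Ipq]; lia.
      have h2 : (p0 <= p <= p1)%N by apply: Imax => [|i /Ipq]; lia.
      by rewrite inE; lia.
    apply: sS => [j js|j jp [jE|jE]|]; last by lia.
    - by have := ds1 j q js qs; have := ds1 p j ps js; lia.
    - by rewrite (_ : j = p) //; exact: val_inj.
    - by rewrite (_ : j = q) //; apply: val_inj; rewrite /= jE pqE.
  have pqE : (q : nat) = (p + d)%N by have := ds p q ps qs; lia.
  rewrite inE; apply/orP; left; apply/imsetP; exists p.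
    rewrite inE; apply: Imax; first by rewrite -pqE -ltnS.
    by move=> i iI; have := Is i p iI ps; have := Is i q iI qs; lia.
  apply: sS => [j js|j jp [jE|jE]|]; last by lia.
  - by have := ds j q js qs; have := ds p j ps js; lia.
  - by rewrite (_ : j = p) //; exact: val_inj.
  - by rewrite (_ : j = q) //; apply: val_inj; rewrite /= jE pqE.
have Sd e (p : nat) : (e <= d)%N -> diam_le d (S e p).
  by move=> ed; apply/diam_leP => i j; rewrite !inE; lia.
(* For e = d - 1 the bound p0 < p keeps p positive, so that F_p misses x_p. *)
have omS e (p : nat) : (p + e <= n)%N -> (d - 1 <= e <= d)%N -> (p0 <= p <= p1)%N ->
   (e == d) || (p0 < p)%N -> facets_above (S e p) = I.
  move=> pe ed pp edp.
  have [q0 q0E] : exists i : V, i = p :> nat by exists (inord p); rewrite inordK //; lia.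
  have [q1 q1E] : exists i : V, i = (p + e)%N :> nat by exists (inord (p + e)); rewrite inordK.
  have q0S : q0 \in S e p.
    by rewrite !inE; apply/andP; split; [apply/negP => /Ip|]; lia.
  have q1S : q1 \in S e p.
    by rewrite !inE; apply/andP; split; [apply/negP => /Ip|]; lia.
  apply/setP => i; rewrite in_facets_above; apply/subsetP/idP => [h|iI j].
    apply: contraT => iI; have := h _ q0S; have := h _ q1S.
    rewrite !inE /inner -!val_eqE /= => h1 h0.
    have iS : i \in S e p by rewrite !inE iI; lia.
    by have := h i iS; rewrite inE eqxx /inner /=; lia.
  rewrite !inE => /andP[jI jp]; have ij : j != i by apply: contraNneq jI => ->.
  by rewrite ij; have := Ip i iI; lia.
rewrite inE => /orP[] /imsetP[p]; rewrite inE => pp ->.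
  by rewrite Sd ?omS ?eqxx //; lia.
by rewrite Sd ?omS ?eqxx //; lia.
Qed.

Section Sums.
Context (A : comNzRingType) (y : A).
Local Open Scope ring_scope.

(** With g = p1 - p0, the fiber has g + 1 sets of full size, contributing 1 each, and g sets with
    one element fewer, contributing y each. *)
Lemma sum_cap I : short I ->
  \sum_(s | diam_le d s && (facets_above s == I)) y ^+ (d.+1 - #|I| - #|s|) =
    1 + (#|facet_cap I| - (d.+1 - #|I|))%:R * (y + 1).
Proof.
move=> sI; have Id := short_card sI.
have [p0 [p1 [p01 p1n Ip Imax capE]]] := short_interval d2 dn sI.
have [_ ->] := card_cap p01 p1n Ip capE.
pose S (e p : nat) := segment p (p + e) :\: I.
have cS e (p : nat) : (p + e <= n)%N -> (p0 <= p <= p1)%N -> (d - 1 <= e)%N ->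
    (forall i, i \in I -> (i <= p + e)%N) -> #|S e p| = (e.+1 - #|I|)%N.
  move=> pe pp de Ie; rewrite card_segmentD //; first by lia.
  by move=> i iI; have := Ip i iI; have := Ie i iI; lia.
have c1 (p : V) : p \in segment p0 p1 -> #|S d p| = (d.+1 - #|I|)%N.
  by rewrite inE => pp; apply: cS => // [||i /Ip]; lia.
have c2 (p : V) : p \in segment p0.+1 p1 -> #|S (d - 1)%N p| = (d - #|I|)%N.
  rewrite inE => pp; rewrite cS ?subn1 ?prednK //; try lia.
  by move=> i /Ip; lia.
have S_inj e : {in segment p0 p1 &, injective (fun p : V => S e p)}.
  have aux (p q : V) : p \in segment p0 p1 -> S e p = S e q -> (q <= p)%N.
    rewrite inE => pp /setP /(_ p); rewrite !inE leqnn leq_addr.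
    have -> : p \notin I by apply/negP => /Ip; lia.
    by rewrite /= => /esym/andP[].
  move=> p q pp qp E; apply/val_inj/anti_leq.
  by rewrite (aux q p) ?(aux p q).
have sub2 : {subset segment p0.+1 p1 <= segment p0 p1}.
  by move=> p; rewrite !inE; lia.
pose F1 := [set S d p | p : V in segment p0 p1].
pose F2 := [set S (d - 1)%N p | p : V in segment p0.+1 p1].
have dis : [disjoint F1 & F2].
  apply/pred0P => s /=; apply/negP => /andP[/imsetP[p pp ->] /imsetP[q qp E]].
  by have := c1 p pp; rewrite E c2 //; lia.
have fibE := facets_above_fiber sI p01 p1n Ip Imax capE.
rewrite -(eq_bigl _ _ (fun s => in_set (fun s => diam_le d s && (facets_above s == I)) s)).
rewrite fibE (eq_bigl [predU F1 & F2]) => [|s]; last by rewrite !inE.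
rewrite bigU //=.
rewrite !big_imset /=; [|by move=> p q /sub2 pp /sub2; exact: S_inj|exact: S_inj].
rewrite (eq_bigr (fun=> 1)); last by move=> p pp; rewrite c1 // subnn.
rewrite [X in _ + X](eq_bigr (fun=> y)); last first.
  by move=> p pp; rewrite c2 // (_ : d.+1 - #|I| - (d - #|I|) = 1)%N ?expr1 //; lia.
rewrite !sumr_const !card_segment; [|lia|lia].
rewrite (_ : p1 + d.+1 - p0 - #|I| - (d.+1 - #|I|) = p1 - p0)%N; last by lia.
rewrite subSS subSn // mulrSr mulr_natl mulrnDl; ring.
Qed.

End Sums.
End Triangulation.

(** * Summing over simplices of diameter at most d in two ways *)

Section CarrierSums.
Context (d n : nat) (d2 : (2 <= d)%N) (dn : (d <= n)%N).
Local Notation V := 'I_n.+1.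
Implicit Types (i j k : V) (I J K s : {set V}).

Local Notation facets_above := (facets_above d).
Local Notation facet_cap := (@facet_cap d n).
Local Notation flat := (flat d).
Local Notation simp := (simp d).
Local Notation short := (short d).
Local Notation rank := (rank d).

Lemma rank_mono J K : flat J -> flat K -> J \subset K -> (rank J <= rank K)%N.
Proof.
move=> fJ fK JK; have [sJ|[I sI JE]] := flat_cases d2 dn fJ.
  rewrite (rank_simp sJ) diam_cap_card //.
  by apply: diam_leW (simp_diam d2 dn sJ); lia.
have [sK|[I' sI' KE]] := flat_cases d2 dn fK.
  by have := simpS d2 dn JK sK; rewrite JE cap_not_simp.
have := subset_leq_card (facets_aboveS d JK).
by rewrite JE KE !facets_above_cap // !rank_cap //; lia.
Qed.

Section PolynomialSums.
Context (A : comNzRingType) (y : A).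
Local Open Scope ring_scope.

(** When K satisfies [simp], all its subsets are flats, so K is the only set with carrier K;
    otherwise this is [sum_cap]. *)
Lemma sum_fiber K : flat K ->
  \sum_(s | diam_le d s && (facets_above s == facets_above K)) y ^+ (rank K - #|s|) =
    1 + (#|K| - rank K)%:R * (y + 1).
Proof.
move=> fK; have [sK|[I sI ->]] := flat_cases d2 dn fK; last first.
  by rewrite facets_above_cap // rank_cap // sum_cap.
rewrite rank_simp // subnn mul0r addr0 (big_pred1 K) ?subnn // => s.
apply/andP/eqP => [[_ /eqP E]|->]; last first.
  by split=> //; apply: diam_leW (simp_diam d2 dn sK); lia.
have sK' : s \subset K by rewrite -(eqP fK) -E sub_capK.
by rewrite -(eqP (simp_flat d2 dn (simpS d2 dn sK' sK))) E (eqP fK).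
Qed.

Lemma sum_diam_simp J : simp J ->
  \sum_(s | diam_le d s && (s \subset J)) y ^+ (rank J - #|s|) =
    (y + 1) ^+ rank J.
Proof.
move=> sJ; rewrite rank_simp // (eq_bigl (fun s => s \subset J)) => [|s].
  by rewrite sum_subsets // subnn mul1r.
apply: andb_idl => sJ'; apply: diam_leS sJ' _.
by apply: diam_leW (simp_diam d2 dn sJ); lia.
Qed.

(* Adding the vertices of the face one by one, each new vertex is joined to the
   rank - 1 vertices of the face preceding it. *)
Lemma sum_diam_cap J I : short I -> J = facet_cap I ->
  \sum_(s | diam_le d s && (s \subset J)) y ^+ (rank J - #|s|) =
    (y + 1) ^+ rank J + (#|J| - rank J)%:R * (y + 1) ^+ (rank J).-1.
Proof.
move=> sI ->; have Id := short_card d2 dn sI.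
have [p0 [p1 [p01 p1n Ip _ capE]]] := short_interval d2 dn sI.
have [capS capN] := card_cap d2 dn p01 p1n Ip capE.
rewrite rank_cap // capN.
set r := (d.+1 - #|I|)%N.
have cS (p q : nat) : (p <= p1.+1)%N -> (p0 + d <= q)%N -> (q <= n)%N ->
    #|segment n p q :\: I| = (q.+1 - p - #|I|)%N.
  by move=> pp pq qn; rewrite card_segmentD // => i /Ip; lia.
have step t : (t <= p1 - p0)%N ->
    \sum_(s | diam_le d s && (s \subset segment n p0 (p0 + d + t) :\: I))
      y ^+ (r - #|s|) = (y + 1) ^+ r + t%:R * (y + 1) ^+ r.-1.
  elim: t => [_|t IH tp].
    rewrite mul0r addr0 addn0 (eq_bigl (fun s => s \subset segment n p0 (p0 + d) :\: I)).
      have c : #|segment n p0 (p0 + d) :\: I| = r by rewrite cS; lia.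
      by rewrite sum_subsets c // subnn mul1r.
    move=> s; apply: andb_idl => /subsetP h; apply/diam_leP => i j /h + /h.
    by rewrite !inE; lia.
  have {IH} := IH (ltnW tp).
  set B := segment n p0 (p0 + d + t) :\: I => IH.
  have qn : (p0 + d + t.+1 < n.+1)%N by lia.
  pose q : V := Ordinal qn.
  have qI : q \notin I by apply/negP => /Ip /=; lia.
  rewrite (bigID (fun s : {set V} => q \in s)) /= addrC.
  rewrite (eq_bigl (fun s => diam_le d s && (s \subset B))) => [|s]; last first.
    rewrite -andbA; congr (_ && _); apply/andP/subsetP => [[/subsetP h qs] j js|h].
      have := h j js; rewrite !inE => /andP[-> jq] /=.
      have : j != q by apply: contraNneq qs => <-.
      by rewrite -val_eqE /=; lia.
    split; last by apply/negP => /h; rewrite !inE /=; lia.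
    by apply/subsetP => j /h; rewrite !inE; lia.
  rewrite IH mulrSr mulrDl mul1r addrA; congr (_ + _).
  (* The sets using the new vertex q are the subsets of the last window C that are not subsets of
     C', which is C without q. They contribute (y + 1)^r - y (y + 1)^(r-1) = (y + 1)^(r-1). *)
  pose C := segment n (p0 + t.+1) (p0 + d + t.+1) :\: I.
  pose C' := segment n (p0 + t.+1) (p0 + d + t) :\: I.
  have cC : #|C| = r by rewrite cS; lia.
  have cC' : #|C'| = r.-1 by rewrite cS; lia.
  have sC : \sum_(s : {set V} | s \subset C) y ^+ (r - #|s|) = (y + 1) ^+ r.
    by rewrite sum_subsets cC // subnn mul1r.
  have sC' : \sum_(s : {set V} | s \subset C') y ^+ (r - #|s|) = y * (y + 1) ^+ r.-1.
    rewrite sum_subsets cC' ?leq_pred // (_ : r - r.-1 = 1)%N ?expr1 //; lia.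
  rewrite (eq_bigl (fun s => (s \subset C) && (q \in s))) => [|s]; last first.
    have [qs|] := boolP (q \in s); rewrite ?andbT ?andbF //.
    apply/andP/subsetP => [[/diam_leP ds /subsetP h] j js|h].
      have := h j js; rewrite !inE => /andP[-> jq] /=.
      by have := ds j q js qs; rewrite /=; lia.
    split; last by apply/subsetP => j /h; rewrite !inE; lia.
    by apply/diam_leP => i j /h + /h; rewrite !inE; lia.
  move: sC; rewrite (bigID (fun s : {set V} => q \in s)) /=.
  rewrite [X in _ + X](eq_bigl (fun s => s \subset C')) => [|s]; last first.
    apply/andP/subsetP => [[/subsetP h qs] j js|h].
      have := h j js; rewrite !inE => /andP[-> jq] /=.
      have : j != q by apply: contraNneq qs => <-.
      by rewrite -val_eqE /=; lia.
    split; last by apply/negP => /h; rewrite !inE /=; lia.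
    by apply/subsetP => j /h; rewrite !inE; lia.
  rewrite sC' => E; apply: (addIr (y * (y + 1) ^+ r.-1)); rewrite E.
  by rewrite -[in LHS](@prednK r) ?exprS; [ring | lia].
have := step _ (leqnn _); rewrite (_ : p0 + d + (p1 - p0) = p1 + d)%N; last by lia.
by rewrite -capS => ->; congr (_ + _%:R * _); lia.
Qed.

Lemma sum_diam J : flat J ->
  \sum_(s | diam_le d s && (s \subset J)) y ^+ (rank J - #|s|) =
    (y + 1) ^+ rank J + (#|J| - rank J)%:R * (y + 1) ^+ (rank J).-1.
Proof.
move=> /(flat_cases d2 dn)[sJ|[I sI JE]]; last exact: sum_diam_cap JE.
by rewrite sum_diam_simp // rank_simp // subnn mul0r addr0.
Qed.

(** Double counting: [sum_diam] gives the total, and grouping the same sets by carrier turns it into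
    a sum of [sum_fiber] terms. This has the shape of the toric recursion in y + 1, with the term K
    = J included. *)
Lemma sum_flats J : flat J ->
  \sum_(K | flat K && (K \subset J))
      (1 + (#|K| - rank K)%:R * (y + 1)) * y ^+ (rank J - rank K) =
    (y + 1) ^+ rank J + (#|J| - rank J)%:R * (y + 1) ^+ (rank J).-1.
Proof.
move=> fJ; rewrite -sum_diam //.
rewrite [RHS](partition_big (fun s => facet_cap (facets_above s))
          (fun K => flat K && (K \subset J))) /=; last first.
  move=> s /andP[_ sJ]; rewrite flat_cap -(eqP fJ).
  by apply: facet_capS; exact: facets_aboveS.
apply: eq_bigr => K /andP[fK KJ]; rewrite -sum_fiber // mulr_suml.
rewrite [RHS](eq_bigl (fun s => diam_le d s && (facets_above s == facets_above K))).
  apply: eq_bigr => s /andP[ds /eqP sK].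
  have sK' : s \subset K by rewrite -(eqP fK) -sK sub_capK.
  rewrite -exprD; congr (_ ^+ _).
  have sr := diam_cap_card d2 dn fK ds sK'.
  by rewrite addnC addnBA // subnK // rank_mono.
move=> s; rewrite -andbA; congr (_ && _).
apply/andP/eqP => [[_ /eqP <-]|E]; first by rewrite facets_aboveK.
rewrite E (eqP fK); split=> //.
by apply: subset_trans KJ; rewrite -(eqP fK) -E sub_capK.
Qed.
End PolynomialSums.
End CarrierSums.

Local Open Scope ring_scope.

(** * Faces of convex hulls *)

Section Farkas.
Context (R : realFieldType).

Lemma mulmx_suml0 k l (c : 'I_k -> R) (w : 'I_k -> 'rV[R]_l) (u : 'cV[R]_l) :
  ((\sum_i c i *: w i) *m u) 0 0 = \sum_i c i * (w i *m u) 0 0.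
Proof.
rewrite mulmx_suml summxE; apply: eq_bigr => i _.
by rewrite -scalemxAl mxE.
Qed.

(** Farkas' lemma, by induction on the number of generators. If the functional a found without the
    generator z is negative on z, the problem is projected along z into the kernel of a. *)
Lemma farkas k l (w : 'I_k -> 'rV[R]_l) (v : 'rV[R]_l) :
  (exists2 c : 'I_k -> R, forall i, 0 <= c i & v = \sum_i c i *: w i) \/
  (exists2 u : 'cV[R]_l, forall i, 0 <= (w i *m u) 0 0 & (v *m u) 0 0 < 0).
Proof.
elim: k w v => [|k IH] w v.
  have [->|v0] := eqVneq v 0.
    by left; exists (fun=> 0) => //; rewrite big_ord0.
  right; exists (- v^T) => [[]//|].
  rewrite mulmxN mxE oppr_lt0 mxE lt_neqAle eq_sym psumr_neq0; last first.
    by move=> i _; rewrite mxE -expr2 sqr_ge0.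
  rewrite sumr_ge0 => [|i _]; last by rewrite mxE -expr2 sqr_ge0.
  rewrite andbT; apply/hasP.
  have [i vi] : exists i, v 0 i != 0.
    apply/existsP; apply: contraNT v0; rewrite negb_exists => /forallP h.
    by apply/eqP/rowP => i; rewrite mxE; apply/eqP; have := h i; rewrite negbK.
  exists i; first by rewrite mem_index_enum.
  by rewrite mxE -expr2 lt_neqAle eq_sym sqrf_eq0 vi sqr_ge0.
pose z := w ord0; pose w0 i := w (lift ord0 i).
have [[c c0 ->]|[a aw av]] := IH w0 v.
  left; exists (fun i => if unlift ord0 i is Some j then c j else 0).
    by move=> i; case: unliftP.
  rewrite big_ord_recl unlift_none scale0r add0r.
  by apply: eq_bigr => i _; rewrite liftK.
set az := (z *m a) 0 0.
have [az0|az0] := lerP 0 az.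
  by right; exists a => // i; case: (unliftP ord0 i) => [j ->|->]; [exact: aw|].
(* A positive multiple of the projection along z onto the kernel of a. *)
pose pr (t : 'rV[R]_l) := (- az) *: t + (t *m a) 0 0 *: z.
have prE t (b : 'cV[R]_l) :
    (pr t *m b) 0 0 = (- az) * (t *m b) 0 0 + (t *m a) 0 0 * (z *m b) 0 0.
  by rewrite /pr mulmxDl -!scalemxAl !mxE.
have [[c c0 E]|[b bw bv]] := IH (pr \o w0) (pr v).
  (* The coefficient of z comes from solving for v; it is nonnegative because a is negative on v and
     nonnegative on the other generators. *)
  left; exists (fun i => if unlift ord0 i is Some j then c j
    else (\sum_j c j * (w0 j *m a) 0 0 - (v *m a) 0 0) / (- az)).
    move=> i; case: unliftP => // _; rewrite divr_ge0 //; last by lra.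
    rewrite subr_ge0 (le_trans (ltW av)) // sumr_ge0 // => j _.
    by rewrite mulr_ge0 // aw.
  rewrite big_ord_recl unlift_none.
  rewrite [X in _ + X](eq_bigr (fun j => c j *: w0 j)); last first.
    by move=> j _; rewrite liftK.
  apply: (@scalerI _ _ (- az)); first by lra.
  have {E} : (- az) *: v = \sum_i c i *: (pr \o w0) i - (v *m a) 0 0 *: z.
    by rewrite -E /pr addrK.
  move=> ->; rewrite scalerDr scalerA mulrC divfK; last by lra.
  rewrite scalerBl addrAC; congr (_ - _); rewrite scaler_suml scaler_sumr.
  rewrite -big_split; apply: eq_bigr => j _.
  by rewrite /pr /= scalerDr !scalerA addrC mulrC.
(* This functional is b composed with [pr], so it vanishes on z. *)
have combE t : (t *m ((- az) *: b + (z *m b) 0 0 *: a)) 0 0 = (pr t *m b) 0 0.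
  rewrite mulmxDr -!scalemxAr mxE prE; congr (_ + _); rewrite mxE //.
  exact: mulrC.
right; exists ((- az) *: b + (z *m b) 0 0 *: a); last by rewrite combE.
move=> i; rewrite combE; case: (unliftP ord0 i) => [j ->|->]; first exact: bw.
by rewrite prE -/z -/az mulNr addrC mulrC subrr.
Qed.

End Farkas.


Local Open Scope classical_set_scope.

Section Hull.
Context {R : realType} {m : nat}.
Local Notation pt := 'rV[R]_m.
Implicit Types (u : 'cV[R]_(1 + m)) (v : pt).

(** Homogeneous coordinates: affine functions become linear and affine independence becomes linear
    independence. *)
Definition homog v : 'rV[R]_(1 + m) := row_mx 1%:M v.

Definition ev u v : R := (homog v *m u) 0 0.

Lemma homog_sum k (c : 'I_k -> R) (q : 'I_k -> pt) :
  \sum_i c i *: homog (q i) = row_mx (\sum_i c i)%:M (\sum_i c i *: q i).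
Proof.
rewrite (eq_bigr (fun i => row_mx (c i)%:M (c i *: q i))); last first.
  by move=> i _; rewrite scale_row_mx scale_scalar_mx mulr1.
apply: (big_rec3 (fun x y z => x = row_mx y%:M z)).
  by rewrite raddf0 row_mx0.
by move=> i x y z _ ->; rewrite add_row_mx raddfD.
Qed.

Lemma homog_inj k (c : 'I_k -> R) (q : 'I_k -> pt) (a : R) (v : pt) :
  \sum_i c i *: homog (q i) = row_mx a%:M v ->
  \sum_i c i = a /\ \sum_i c i *: q i = v.
Proof.
rewrite homog_sum => /eq_row_mx[/matrixP/(_ 0 0) + ->].
by rewrite !mxE !eqxx.
Qed.

Lemma ev_sum u k (c : 'I_k -> R) (q : 'I_k -> pt) : \sum_i c i = 1 ->
  ev u (\sum_i c i *: q i) = \sum_i c i * ev u (q i).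
Proof. by move=> c1; rewrite /ev -mulmx_suml0 homog_sum c1. Qed.

Lemma evE u v : ev u v = usubmx u 0 0 + \sum_i v 0 i * dsubmx u i 0.
Proof. by rewrite /ev /homog -[u in LHS]vsubmxK mul_row_col mul1mx !mxE. Qed.

Lemma evD u u' v : ev (u + u') v = ev u v + ev u' v.
Proof. by rewrite /ev mulmxDr mxE. Qed.

Lemma evZ (a : R) u v : ev (a *: u) v = a * ev u v.
Proof. by rewrite /ev -scalemxAr mxE. Qed.

Definition const_fun_mx (a : R) : 'cV[R]_(1 + m) := col_mx a%:M 0.

Lemma ev_const a v : ev (const_fun_mx a) v = a.
Proof. by rewrite /ev /homog mul_row_col mul1mx mulmx0 addr0 mxE eqxx. Qed.

Lemma faceE (P F : set pt) : face P F <->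
  exists2 u, forall v, P v -> 0 <= ev u v & F = P `&` [set v | ev u v = 0].
Proof.
split=> [[a [b [Pb ->]]]|[u Pu ->]].
  have E v : ev (col_mx b%:M (- a^T)) v = b - dot a v.
    rewrite evE col_mxKu col_mxKd mxE eqxx mulr1n; congr (_ + _).
    rewrite /dot -sumrN; apply: eq_bigr => i _.
    by rewrite !mxE mulrN mulrC.
  exists (col_mx b%:M (- a^T)) => [v /Pb|]; first by rewrite E subr_ge0.
  by apply/seteqP; split=> v [Pv] /=; rewrite E; [move=> ->; rewrite subrr|
    move=> /eqP; rewrite subr_eq0 => /eqP].
have E v : ev u v = usubmx u 0 0 - dot (- (dsubmx u)^T) v.
  rewrite evE; congr (_ + _); rewrite /dot -sumrN; apply: eq_bigr => i _.
  by rewrite !mxE mulNr opprK mulrC.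
exists (- (dsubmx u)^T), (usubmx u 0 0); split=> [v /Pu|].
  by rewrite E subr_ge0.
by apply/seteqP; split=> v [Pv] /=; rewrite E; [move=> /eqP; rewrite subr_eq0 => /eqP
  |move=> ->; rewrite subrr].
Qed.

Context (N : nat) (x : 'I_N -> pt).
Implicit Types (J K L : {set 'I_N}).

Definition hull J : set pt := conv (x @` [set` J]).

Lemma hullP J v : hull J v <-> exists c : 'I_N -> R,
  [/\ forall j, 0 <= c j, forall j, j \notin J -> c j = 0, \sum_j c j = 1
    & v = \sum_j c j *: x j].
Proof.
split=> [[k [q [c [qJ c0 c1 ->]]]]|[c [c0 cJ c1 ->]]]; last first.
  exists #|J|, (fun i => x (enum_val i)), (fun i => c (enum_val i)).
  split=> // [i||].
  - by exists (enum_val i) => //=; exact: enum_valP.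
  - rewrite -(@big_enum_val _ _ _ _ (mem J) (fun j => c j)) /= -c1 [RHS](bigID (mem J)) /=.
    by rewrite [X in _ = _ + X]big1 ?addr0.
  - rewrite -(@big_enum_val _ _ _ _ (mem J) (fun j => c j *: x j)) /= [LHS](bigID (mem J)) /=.
    by rewrite [X in _ + X]big1 ?addr0 // => j /cJ ->; rewrite scale0r.
have /choice[f fP] i : exists j, j \in J /\ x j = q i.
  by have [j jJ <-] := qJ i; exists j.
exists (fun j => \sum_(i | f i == j) c i); split=> [j|j jJ||].
- by apply: sumr_ge0.
- rewrite big1 // => i /eqP fi; have [] := fP i; rewrite fi => jJ'.
  by rewrite jJ' in jJ.
- by rewrite -c1 [RHS](partition_big f xpredT).
- rewrite (partition_big f xpredT) //=; apply: eq_bigr => j _.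
  rewrite scaler_suml; apply: eq_bigr => i /eqP <-.
  by have [_ ->] := fP i.
Qed.

Lemma mem_hull J j : j \in J -> hull J (x j).
Proof.
move=> jJ; apply/hullP; exists (fun i => (i == j)%:R); split=> [i|i iJ||].
- by rewrite ler0n.
- by case: eqP => // ij; rewrite ij jJ in iJ.
- by rewrite (bigD1 j) //= eqxx big1 ?addr0 // => i /negPf ->.
- rewrite (bigD1 j) //= eqxx scale1r big1 ?addr0 // => i /negPf ->.
  by rewrite scale0r.
Qed.

Lemma conv_hull (A : set pt) J : A `<=` hull J -> conv A `<=` hull J.
Proof.
move=> AJ _ [k [q [c [qA c0 c1 ->]]]].
have /choice[e eP] i := (hullP J (q i)).1 (AJ _ (qA i)).
apply/hullP; exists (fun j => \sum_i c i * e i j); split=> [j|j jJ||].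
- by apply: sumr_ge0 => i _; have [e0 _ _ _] := eP i; rewrite mulr_ge0.
- by rewrite big1 // => i _; have [_ -> //] := eP i; rewrite mulr0.
- rewrite exchange_big /= -[RHS]c1; apply: eq_bigr => i _.
  by have [_ _ e1 _] := eP i; rewrite -mulr_sumr e1 mulr1.
- under [RHS]eq_bigr do rewrite scaler_suml.
  rewrite exchange_big /=; apply: eq_bigr => i _.
  have [_ _ _ ->] := eP i; rewrite scaler_sumr.
  by apply: eq_bigr => j _; rewrite scalerA.
Qed.

Lemma hullS J K : J \subset K -> hull J `<=` hull K.
Proof.
move=> /subsetP JK; apply: conv_hull => _ [j jJ <-].
by apply: mem_hull; exact: JK.
Qed.

Lemma hull0 : hull set0 = classical_sets.set0.
Proof.
apply/seteqP; split=> // v /hullP[c [_ c0 + _]].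
by rewrite big1 => [/eqP|j _]; [rewrite eq_sym oner_eq0|rewrite c0 ?inE].
Qed.

(** The counterpart of [face] on index sets, see [exposed_face] and [face_exposed]. *)
Definition exposed J K : Prop := K \subset J /\
  exists u, forall j, j \in J -> 0 <= ev u (x j) /\ (ev u (x j) == 0) = (j \in K).

Lemma exposed_face J K : exposed J K -> face (hull J) (hull K).
Proof.
move=> [KJ [u uP]]; apply/faceE; exists u => [v /hullP[c [c0 cJ c1 ->]]|].
  rewrite ev_sum // sumr_ge0 // => j _.
  have [/uP[u0 _]|/cJ ->] := boolP (j \in J); last by rewrite mul0r.
  by rewrite mulr_ge0.
apply/seteqP; split=> v.
  move=> vK; split; first exact: hullS vK.
  have /hullP[c [c0 cK c1 ->]] := vK; rewrite /= ev_sum // big1 // => j _.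
  have [jK|/cK ->] := boolP (j \in K); last by rewrite mul0r.
  have [_] := uP j (subsetP KJ j jK).
  by rewrite jK => /eqP ->; rewrite mulr0.
move=> [/hullP[c [c0 cJ c1 vE]] /=]; rewrite vE ev_sum // => /eqP.
have t0 j : 0 <= c j * ev u (x j).
  have [/uP[u0 _]|/cJ ->] := boolP (j \in J); last by rewrite mul0r.
  by rewrite mulr_ge0.
rewrite psumr_eq0 // => /allP h.
apply/hullP; exists c; split=> // j jK.
have [jJ|/cJ //] := boolP (j \in J); have [_ uj] := uP j jJ.
have := h j (mem_index_enum j); rewrite /= mulf_eq0 uj (negPf jK) orbF.
by move=> /eqP.
Qed.

Lemma face_exposed J F : face (hull J) F -> exists2 K, exposed J K & F = hull K.
Proof.
move=> /faceE[u uP ->]; pose K := [set j in J | ev u (x j) == 0]%SET.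
have eK : exposed J K.
  split; first by apply/subsetP => j; rewrite inE => /andP[].
  by exists u => j jJ; rewrite inE jJ; split=> //; exact/uP/mem_hull.
exists K => //; apply/seteqP; split=> v.
  move=> [/hullP[c [c0 cJ c1 vE]] /=]; rewrite vE ev_sum // => /eqP.
  have t0 j : 0 <= c j * ev u (x j).
    have [/mem_hull/uP|/cJ ->] := boolP (j \in J); last by rewrite mul0r.
    exact: mulr_ge0.
  rewrite psumr_eq0 // => /allP h; apply/hullP; exists c; split=> // j jK.
  have [jJ|/cJ //] := boolP (j \in J).
  have := h j (mem_index_enum j); rewrite /= mulf_eq0 => /orP[/eqP //|uj].
  by move: jK; rewrite inE jJ uj.
move=> vK; split; first by apply: hullS vK; have [] := eK.
have /hullP[c [c0 cK c1 ->]] := vK; rewrite /= ev_sum // big1 // => j _.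
have [jK|/cK ->] := boolP (j \in K); last by rewrite mul0r.
by move: jK; rewrite inE => /andP[_ /eqP ->]; rewrite mulr0.
Qed.

Lemma exposed_refl J : exposed J J.
Proof.
split=> //; exists (const_fun_mx 0) => j jJ; rewrite ev_const lexx.
by rewrite eqxx jJ.
Qed.

Lemma exposed_sub J K L : K \subset J -> exposed L K -> J \subset L -> exposed J K.
Proof.
move=> KJ [KL [u uP]] JL; split=> //; exists u => j jJ.
by apply: uP; exact: (subsetP JL).
Qed.

(** Off J, a large multiple of the function exposing J dominates the function exposing K. *)
Lemma exposed_trans J K L : exposed L J -> exposed J K -> exposed L K.
Proof.
move=> [JL [u uP]] [KJ [t tP]]; split; first exact: subset_trans JL.
(* The terms are nonnegative, so the sum bounds each of the finitely many ratios. *)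
pose M := \sum_(j in L :\: J) (`|ev t (x j)| + 1) / ev u (x j).
exists (M *: u + t) => j jL; rewrite evD evZ; have [u0 uj] := uP j jL.
have [jJ|jJ] := boolP (j \in J).
  by move: uj; rewrite jJ => /eqP ->; rewrite mulr0 add0r; exact: tP.
have {}u0 : 0 < ev u (x j) by rewrite lt_neqAle u0 eq_sym uj jJ.
suff h : 0 < M * ev u (x j) + ev t (x j).
  rewrite ltW // gt_eqF //; split=> //; apply/esym/negbTE.
  by apply: contraNN jJ; exact: (subsetP KJ).
have jLJ : j \in L :\: J by rewrite inE jJ.
have Mj : (`|ev t (x j)| + 1) / ev u (x j) <= M.
  rewrite /M (bigD1 j) //= lerDl sumr_ge0 // => i /andP[+ _].
  rewrite inE => /andP[_ /uP[u1 _]].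
  by rewrite divr_ge0 // addr_ge0.
have := ler_wpM2r (ltW u0) Mj; rewrite divfK ?gt_eqF // => {}Mj.
have : - `|ev t (x j)| <= ev t (x j) by rewrite lerNl -normrN ler_norm.
by move: Mj; set t1 := `|_|; lra.
Qed.

Lemma exposedI J K L : exposed L J -> exposed L K -> exposed L (J :&: K).
Proof.
move=> [JL [u uP]] [KL [t tP]]; split; first exact: subset_trans (subsetIl _ _) JL.
exists (u + t) => j jL; have [u0 uj] := uP j jL; have [t0 tj] := tP j jL.
by rewrite evD addr_ge0 // paddr_eq0 // uj tj inE.
Qed.

Definition homogmx J : 'M[R]_(#|J|, 1 + m) := \matrix_i homog (x (enum_val i)).

Lemma homog_sub J j : j \in J -> (homog (x j) <= homogmx J)%MS.
Proof.
move=> jJ; have -> : homog (x j) = row (enum_rank_in jJ j) (homogmx J).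
  by rewrite rowK enum_rankK_in.
exact: row_sub.
Qed.

Lemma homogmx_sub J l (A : 'M[R]_(l, 1 + m)) :
  (forall j, j \in J -> (homog (x j) <= A)%MS) -> (homogmx J <= A)%MS.
Proof.
by move=> h; apply/row_subP => i; rewrite rowK; apply/h/enum_valP.
Qed.

Lemma aff_indep_free k (p : 'I_k -> pt) :
  aff_indep p <-> row_free (\matrix_i homog (p i)).
Proof.
have E (u : 'rV[R]_k) : u *m (\matrix_i homog (p i)) = \sum_i u 0 i *: homog (p i).
  by rewrite mulmx_sum_row; apply: eq_bigr => i _; rewrite rowK.
split=> [pi|pf c c0 cp i].
  apply/inj_row_free => u; rewrite E => uE.
  have [|u0 up] := @homog_inj _ (u 0) p 0 0; first by rewrite uE raddf0 row_mx0.
  by apply/rowP => i; rewrite mxE; exact: pi u0 up i.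
have : (\row_i c i) *m (\matrix_i homog (p i)) = 0.
  rewrite E (eq_bigr (fun i => c i *: homog (p i))) => [|j _]; last by rewrite mxE.
  by rewrite homog_sum c0 cp raddf0 row_mx0.
move/eqP; rewrite mulmx_free_eq0 // => /eqP/rowP/(_ i).
by rewrite !mxE.
Qed.

(** Points of the hull lie in the row span of the homogenized vertices, and a maximal set of
    independent rows consists of affinely independent vertices. *)
Lemma rk_hull J : rk (hull J) = \rank (homogmx J).
Proof.
apply/anti_leq/andP; split.
  have [p pi pJ] := rk_attained (hull J).
  have /eqP <- := (aff_indep_free p).1 pi.
  apply: mxrankS; apply/row_subP => i; rewrite rowK.
  have /hullP[c [_ cJ c1 ->]] := pJ i.
  rewrite /homog -c1 -homog_sum summx_sub // => j _.
  have [jJ|/cJ ->] := boolP (j \in J); last by rewrite scale0r sub0mx.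
  by rewrite scalemx_sub // homog_sub.
pose f := maxrankfun (homogmx J).
apply: (@rk_ge _ _ _ (fun i => x (enum_val (f i)))) => [|i].
  apply/aff_indep_free; have := maxrowsub_free (homogmx J).
  by congr row_free; apply/row_matrixP => i; rewrite row_rowsub !rowK.
by apply: mem_hull; exact: enum_valP.
Qed.

Lemma rk_hull_card J : (rk (hull J) <= #|J|)%N.
Proof. by rewrite rk_hull rank_leq_row. Qed.

End Hull.

(** * Polytopes as convex hulls of their vertices *)

Section Polytope.
Context {R : realType} {m : nat}.
Local Notation pt := 'rV[R]_m.

Lemma hull_setT N (x : 'I_N -> pt) : hull x setT = conv (range x).
Proof.
rewrite /hull; congr conv; congr (x @` _).
by apply/seteqP; split=> // j _ /=; rewrite in_setT.
Qed.

(** In a generating family of least size every point is a vertex: by [farkas] it is either a convex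
    combination of the others, and could be dropped, or separated from them by an affine function,
    which exposes it after a shift by a constant. *)
Lemma polytope_vertices (P : set pt) : polytope P -> exists2 N : nat,
  exists y : 'I_N -> pt, P = hull y setT & P = conv (vertices P).
Proof.
move=> [V /finite_seqP[s ->] ->] {V}.
pose Q N := `[< exists y : 'I_N -> pt, conv [set` s] = hull y setT >].
have exQ : exists N, Q N.
  exists (size s); apply/asboolP; exists (tnth (in_tuple s)).
  rewrite hull_setT; congr conv; apply/seteqP; split=> v /=.
    by move=> /(tnthP (in_tuple s))[i ->]; exists i.
  by move=> [i _ <-]; exact: mem_tnth.
case: (ex_minnP exQ) => N /asboolP[y PE] Nmin; exists N; first by exists y.
rewrite PE; suff yv i : vertices (hull y setT) (y i).
  apply/seteqP; split=> v; last first.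
    move: v; apply: conv_hull => v [a [b [_ /seteqP[/(_ v erefl)[]]]]] //.
  rewrite {1}/hull => -[k [q [c [qy c0 c1 ->]]]]; exists k, q, c; split=> // j.
  by have [i _ <-] := qy j; exact: yv.
case: N y PE Nmin i => [y _ _ []//|N y PE Nmin i].
have [[c c0 E]|[u uy ui]] := farkas (fun j => homog (y (lift i j))) (homog (y i)).
  exfalso; suff : (N.+1 <= N)%N by rewrite ltnn.
  apply: Nmin; apply/asboolP; exists (y \o lift i); rewrite PE.
  have [c1 cy] := homog_inj (esym E).
  apply/seteqP; split; last first.
    by apply: conv_hull => _ [j _ <-]; exact: mem_hull.
  apply: conv_hull => _ [j _ <-]; case: (unliftP i j) => [k ->|->].
    exact: (@mem_hull _ _ _ (y \o lift i)).
  apply/hullP; exists c; split=> // k.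
  by rewrite in_setT.
rewrite /vertices /=; have -> : [set y i] = hull y [set i]%SET.
  apply/seteqP; split=> [_ ->|]; first by apply: mem_hull; rewrite inE.
  move=> v /hullP[c [_ c0 c1 ->]] /=.
  rewrite (bigD1 i) //= big1 => [|j ji]; last by rewrite c0 ?scale0r // inE.
  move: c1; rewrite (bigD1 i) //= big1 => [|j ji]; last by rewrite c0 // inE.
  by rewrite !addr0 => ->; rewrite scale1r.
apply: exposed_face; split; first exact: subsetT.
exists (u + const_fun_mx (- ev u (y i))) => j _; rewrite evD ev_const inE.
case: (unliftP i j) => [k ->|->]; last by rewrite subrr !eqxx.
have := uy k; rewrite -/(ev u (y (lift i k))) => u0.
have ui' : ev u (y i) < 0 := ui.
rewrite [lift i k == i]eq_sym (negPf (neq_lift i k)); split; first by lra.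
by apply/negbTE; rewrite gt_eqF //; lra.
Qed.

End Polytope.

(** * Faces as intersections of facets *)

Section Faces.
Context {R : realType} {m N : nat} (x : 'I_N -> 'rV[R]_m).
Context (x_inj : injective x).
Context (x_vertex : forall j, face (hull x setT) [set x j]).
Implicit Types (J K L M : {set 'I_N}).

Lemma exposed1 j : exposed x setT [set j]%SET.
Proof.
have [K eK E] := face_exposed (x_vertex j).
suff -> : [set j]%SET = K by [].
have sK : K \subset [set j]%SET.
  apply/subsetP => k kK; have : hull x K (x k) by exact: mem_hull.
  by rewrite -E inE => /x_inj ->.
have [K0|[k kK]] := set_0Vmem K.
  by have : [set x j] (x j) by []; rewrite E K0 hull0.
apply/eqP; rewrite eqEsubset sK andbT sub1set.
by have := subsetP sK k kK; rewrite inE => /eqP <-.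
Qed.

(** The function exposing x_j is positive at all other points, so a convex combination equal to x_j
    puts no weight on them. *)
Lemma hull_mem K j : hull x K (x j) -> j \in K.
Proof.
have [_ [u uP]] := exposed1 j.
move=> /hullP[c [c0 cK c1 E]]; apply: contraT => jK.
have : \sum_k c k * ev u (x k) == 0.
  rewrite -ev_sum // -E; have [_ ->] := uP j (in_setT j).
  by rewrite inE.
rewrite psumr_eq0 => [/allP h|k _]; last first.
  by rewrite mulr_ge0 //; have [] := uP k (in_setT k).
have /eqP := c1; rewrite big1 ?(eq_sym 0) ?oner_eq0 // => k _.
have := h k (mem_index_enum k); rewrite /= mulf_eq0.
have [_ ->] := uP k (in_setT k).
by rewrite inE => /orP[/eqP //|/eqP ->]; exact: cK.
Qed.

Lemma hull_inj : injective (hull x).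
Proof.
by move=> J K E; apply/setP => j; apply/idP/idP => /(mem_hull x);
  [rewrite E | rewrite -E] => /hull_mem.
Qed.

(* Rotate a supporting hyperplane of [hull x K] around the face it touches,
   away from [x j], until it touches a facet. *)
Lemma facet_avoiding K j : exposed x setT K -> j \notin K ->
  exists M, [/\ exposed x setT M, K \subset M, j \notin M
    & (rk (hull x M)).+1 = rk (hull x setT)].
Proof.
move=> eK jK.
pose Q M := `[< exposed x setT M >] && ((K \subset M) && (j \notin M)).
have QK : Q K by rewrite /Q asboolT // subxx.
have [M /andP[/asboolP eM /andP[KM jM]] Mmax] :=
  arg_maxnP (fun M : {set 'I_N} => #|M|) QK.
exists M; split=> //; apply/anti_leq/andP; split.
  apply: rk_face; first exact: exposed_face.
  by move=> /hull_inj MT; rewrite MT in_setT in jM.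
(* If M and x_j span all the points, the rank of M is at most one short. Otherwise a function
   vanishing on M and x_j but not everywhere enlarges M, against its maximality. *)
pose C := col_mx (homogmx x M) (homog (x j)).
have hC w : w \in j |: M -> (homog (x w) <= C)%MS.
  rewrite -addsmxE in_setU1 => /orP[/eqP ->|wM]; first exact: addsmxSr.
  by apply: submx_trans (addsmxSl _ _); exact: homog_sub.
have [allC|] := boolP [forall w, homog (x w) <= C]%MS.
  rewrite !rk_hull.
  apply: (@leq_trans (\rank C)).
    by apply: mxrankS; apply: homogmx_sub => w _; exact: (forallP allC).
  rewrite -addsmxE (leq_trans (mxrank_adds_leqif _ _)) //.
  by rewrite -[leqRHS]addn1 leq_add2l rank_leq_row.
rewrite negb_forall => /existsP[w wC]; exfalso.
have [u0 [uC uw]] : exists u, (forall k, k \in j |: M -> ev u (x k) = 0) /\ ev u (x w) < 0.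
  have [c cw] : exists c, (homog (x w) *m cokermx C) 0 c != 0.
    apply/existsP; apply: contraNT wC; rewrite negb_exists => /forallP h.
    rewrite submxE; apply/eqP/rowP => c; rewrite [RHS]mxE; apply/eqP.
    by have := h c; rewrite negbK.
  pose u := col c (cokermx C).
  have uE v : ev u v = (homog v *m cokermx C) 0 c.
    by rewrite /ev [LHS]mxE [RHS]mxE; apply: eq_bigr => k _; rewrite [X in _ * X = _]mxE.
  have uC k : k \in j |: M -> ev u (x k) = 0.
    by move=> /hC; rewrite submxE uE => /eqP ->; rewrite mxE.
  move: cw; rewrite -uE neq_lt => /orP[u0|u0]; first by exists u.
  exists ((-1) *: u); split=> [k /uC|]; rewrite evZ; first by move=> ->; rewrite mulr0.
  by rewrite mulN1r oppr_lt0.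
have [_ [f fP]] := eM.
have f0 k : 0 <= ev f (x k) by have [] := fP k (in_setT k).
have fE k : (ev f (x k) == 0) = (k \in M) by have [] := fP k (in_setT k).
(* The least ratio tells when f, tilted by u0, first acquires a new zero. It stays nonnegative up to
   there, and its value at x_j stays positive. *)
pose r k := ev f (x k) / - ev u0 (x k).
have [w1 w1u w1min] : exists2 w1, ev u0 (x w1) < 0 &
    forall k, ev u0 (x k) < 0 -> r w1 <= r k.
  by case: (arg_minP (P := fun k => ev u0 (x k) < 0) r uw) => w1; exists w1.
have w1M : w1 \notin M.
  by apply: contraTN w1u => w1M; rewrite uC ?ltxx // in_setU1 w1M orbT.
have rw0 : 0 <= r w1 by rewrite divr_ge0 // oppr_ge0 ltW.
pose f' := f + r w1 *: u0.
have f'E k : ev f' (x k) = ev f (x k) + r w1 * ev u0 (x k) by rewrite evD evZ.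
have f'0 k : 0 <= ev f' (x k).
  rewrite f'E; have [u1|u1] := lerP 0 (ev u0 (x k)).
    by rewrite addr_ge0 // mulr_ge0.
  have := w1min k u1; rewrite ler_pdivlMr ?oppr_gt0 //.
  by rewrite mulrN; lra.
pose M' := [set k | ev f' (x k) == 0]%SET.
have /Mmax : Q M'.
  rewrite /Q asboolT; last first.
    by split; [exact: subsetT|exists f' => k _; rewrite inE].
  rewrite /=; apply/andP; split.
    apply/subsetP => k kK; have kM := subsetP KM k kK.
    rewrite inE f'E uC ?in_setU1 ?kM ?orbT // mulr0 addr0.
    by rewrite fE.
  by rewrite inE f'E uC ?in_setU1 ?eqxx // mulr0 addr0 fE.
apply/negP; rewrite -ltnNge; apply: proper_card; apply/properP; split.
  apply/subsetP => k kM; rewrite inE f'E uC ?in_setU1 ?kM ?orbT //.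
  by rewrite mulr0 addr0 fE.
exists w1 => //; rewrite inE f'E /r -mulrN1 -!mulrA.
have u10 : ev u0 (x w1) != 0 by rewrite lt_eqF.
rewrite mulrN1 invrN mulNr mulVf // mulrN1 subrr //.
Qed.

Context (I : finType) (Phi : I -> {set 'I_N}).
Context (facetsE : facets (hull x setT) = range (hull x \o Phi)).

(** By [facet_avoiding] every vertex outside a face is missed by a facet containing the face;
    conversely faces are closed under intersection. *)
Lemma exposedP K :
  exposed x setT K <-> K = \bigcap_(i | K \subset Phi i) Phi i.
Proof.
have ePhi i : exposed x setT (Phi i).
  have [] : facets (hull x setT) (hull x (Phi i)) by rewrite facetsE; exists i.
  by move=> /face_exposed[M eM /hull_inj ->].
split=> [eK|->].
  apply/eqP; rewrite eqEsubset; apply/andP; split; first exact/bigcapsP.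
  apply/subsetP => j /bigcapP h; apply: contraT => jK.
  have [M [eM KM jM rM]] := facet_avoiding eK jK.
  have : facets (hull x setT) (hull x M) by split=> //; exact: exposed_face.
  rewrite facetsE => -[i _ /= /hull_inj ME].
  by move: jM; rewrite -ME h // ME.
elim/big_rec: _ => [|i J _ eJ]; first exact: exposed_refl.
exact: exposedI.
Qed.

End Faces.

(** * The toric g-polynomials of the faces *)

Section Rank.
Context (d n : nat) (d2 : (2 <= d)%N) (dn : (d <= n)%N).
Implicit Types (J K I : {set 'I_n.+1}).

Lemma flatT : flat d [set: 'I_n.+1].
Proof.
have -> : setT = @facet_cap d n set0 by rewrite /facet_cap big_set0.
exact: flat_cap.
Qed.

Lemma short0 : short d (set0 : {set 'I_n.+1}).
Proof. by apply/shortP => // i; rewrite inE. Qed.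

Lemma rankT : rank d [set: 'I_n.+1] = d.+1.
Proof.
have -> : setT = @facet_cap d n set0 by rewrite /facet_cap big_set0.
by rewrite rank_cap ?cards0 ?short0.
Qed.

Lemma simp1 j : simp d [set j : 'I_n.+1].
Proof.
apply/orP; left; apply/diam_leP => i k; rewrite !inE => /eqP -> /eqP ->.
exact: leq_addr.
Qed.

(** Outside the simplicial case I has at least d - 1 elements strictly between p1 and p0 + d, which
    forces p1 = p0: there is a single top simplex. *)
Lemma rank_le2 K : flat d K -> (rank d K <= 2)%N -> rank d K = #|K|.
Proof.
move=> fK; have [sK|[I sI ->]] := flat_cases d2 dn fK.
  by rewrite rank_simp.
rewrite rank_cap //; have [p0 [p1 [p01 p1n Ip _ capE]]] := short_interval d2 dn sI.
have [_ ->] := card_cap d2 dn p01 p1n Ip capE.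
have /subset_leq_card : I \subset segment n p1.+1 (p0 + d - 1).
  by apply/subsetP => i /Ip; rewrite inE; lia.
rewrite card_segment; lia.
Qed.

End Rank.

Section ToricOfFlats.

(** For r > 2, dividing by X - 1 gives h the coefficients 1, 1 + g, ..., 1 + g, 1, so only the
    difference in degree 1 survives. For r at most 2 the truncation in [toric_g_of_h] removes that
    degree too, hence the condition on g. *)
Lemma toric_g_of_linear (r : nat) (g : int) (h : {poly int}) :
  (0 < r)%N -> ((r <= 2)%N -> g = 0) ->
  ('X - 1) * h + (1 + g *: 'X) = 'X^r + g *: 'X^(r.-1) :> {poly int} ->
  (forall i, (0 < i)%N -> (i.+1 < r)%N -> h`_i = 1 + g) /\
  toric_g_of_h r.-1 h = 1 + g *: 'X.
Proof.
move=> r0 gr E.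
pose H : {poly int} := \poly_(i < r) 1 + g%:P * 'X * \poly_(i < r - 2) 1.
have geo k : ('X - 1) * \poly_(i < k) 1 = 'X^k - 1 :> {poly int}.
  rewrite subrX1 poly_def; congr (_ * _); apply: eq_bigr => i _.
  by rewrite scale1r.
have hH : h = H.
  have X1 : ('X - 1 : {poly int}) != 0 by rewrite -polyC1 polyXsubC_eq0.
  apply: (mulfI X1).
  have -> : ('X - 1) * h = 'X^r + g *: 'X^(r.-1) - (1 + g *: 'X) by rewrite -E addrK.
  rewrite /H mulrDr geo mulrCA geo -!mul_polyC.
  have [r2|r2] := leqP r 2.
    by rewrite gr // !mul0r !addr0.
  have -> : 'X^(r.-1) = 'X * 'X^(r - 2) :> {poly int}.
    by rewrite -exprS; congr (_ ^+ _); lia.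
  ring.
have c i : h`_i = (i < r)%N%:R + g * ((0 < i) && (i.-1 < r - 2))%N%:R.
  rewrite hH coefD -mulrA coefCM coefXM !coef_poly.
  by case: i => [|i] /=; [case: ifP => _; rewrite ?mulr0 | do 2!case: ifP => _].
have hi i : (0 < i)%N -> (i.+1 < r)%N -> h`_i = 1 + g.
  move=> i0 ir; have [ir1 ir2] : (i < r)%N /\ (i.-1 < r - 2)%N.
    by clear -i0 ir; lia.
  by rewrite c i0 ir1 ir2 mulr1.
split=> //; rewrite /toric_g_of_h c r0 mulr0 addr0.
have [r2|r2] := leqP r 2.
  rewrite big_geq ?gr ?scale0r //.
  by clear -r2; lia.
rewrite big_ltn; last by clear -r2; lia.
rewrite hi // c r0 mulr0 addr0 addrAC subrr add0r expr1 big_nat big1 ?addr0 //.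
move=> i /andP[i1 ir].
have [ir1 [i0 [ir2 i2]]] :
    ((i.+1 < r) /\ (0 < i) /\ (i.-1.+1 < r) /\ (0 < i.-1))%N.
  by clear -ir i1 r2; lia.
by rewrite !hi // subrr scale0r.
Qed.

End ToricOfFlats.

Lemma fset_set_finset (T : finType) (B : {set T}) :
  fset_set [set` B] = [fset t | t in B]%fset.
Proof.
apply/fsetP => t; rewrite in_fset_set ?finite_finset // mem_setE.
by apply/idP/imfsetP => [tB|[s sB ->] //]; exists t.
Qed.

Lemma card_fset_set_image (T : finType) (U : choiceType) (f : T -> U)
    (B : {set T}) : {in B &, injective f} ->
  #|` fset_set (f @` [set` B])| = #|B|.
Proof.
move=> f_inj; rewrite fset_set_image // fset_set_finset.
rewrite card_in_imfset //=; first by rewrite card_imfset //= -cardE.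
by move=> _ _ /imfsetP[t tB ->] /imfsetP[u uB ->]; exact: f_inj.
Qed.

(** * Dimensions, toric polynomials and flag numbers of the faces of a multiplex *)

Section Multiplex.
Context {R : realType} {m d n : nat} (d2 : (2 <= d)%N) (dn : (d <= n)%N).
Context (x : 'I_n.+1 -> 'rV[R]_m).
Context (x_inj : injective x).
Context (x_vertex : forall j, face (hull x setT) [set x j]).
Context (facetsE : facets (hull x setT) = range (hull x \o @facet_set d n)).
Context (rk_hullT : rk (hull x setT) = d.+1).
Implicit Types (J K I : {set 'I_n.+1}).

Local Notation hull := (hull x).
Local Notation rank := (rank d).
Local Notation flat := (flat d).

Let h_inj : injective hull := hull_inj x_inj x_vertex.

Lemma exposed_flat K : exposed x setT K <-> flat K.
Proof.
have E : facet_cap d (facets_above d K) = (\bigcap_(i | K \subset facet_set d i) facet_set d i)%SET.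
  by apply: eq_bigl => i; rewrite in_facets_above.
rewrite (exposedP x_inj x_vertex facetsE) -E flatE.
by split=> [{1}<-|/eqP].
Qed.

Lemma face_flat J F : flat J ->
  face (hull J) F <-> exists K, [/\ flat K, K \subset J & F = hull K].
Proof.
move=> /exposed_flat eJ; split=> [/face_exposed[K eK ->]|[K [/exposed_flat eK KJ ->]]].
  exists K; split=> //; last by have [] := eK.
  by apply/exposed_flat; exact: exposed_trans eJ eK.
by apply: exposed_face; apply: exposed_sub eK _.
Qed.

Lemma rk_proper J K : flat J -> flat K -> J \proper K -> (rk (hull J) < rk (hull K))%N.
Proof.
move=> fJ fK JK; apply: rk_face; first by apply/face_flat => //; exists J; rewrite proper_sub.
by move=> /h_inj E; move: JK; rewrite E properxx.
Qed.

(** All subsets of K are flats, so deleting vertices one at a time gives a chain of faces as long as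
    the upper bound allows. *)
Lemma rk_simp K : simp d K -> rk (hull K) = #|K|.
Proof.
move=> sK; apply/anti_leq; rewrite rk_hull_card /=.
have [k kK] := ubnP #|K|; elim: k K sK kK => // k IH K sK kK.
have [->|[j jK]] := set_0Vmem K; first by rewrite cards0.
have pK := properD1 jK; have sK' := simpS d2 dn (subD1set K j) sK.
have cK : #|K| = #|K :\ j|.+1 by rewrite (cardsD1 j K) jK.
rewrite cK; apply: leq_ltn_trans (rk_proper _ _ pK); try exact: simp_flat.
by apply: IH; rewrite // -cK.
Qed.

Lemma cap_proper I i : short d I -> short d (i |: I) -> i \notin I ->
  facet_cap d (i |: I) \proper facet_cap d I.
Proof.
move=> sI siI iI; rewrite properE facet_capS ?subsetUr //=.
rewrite -sub_facet_cap facets_above_cap //; apply: contra iI => /subsetP.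
by apply; rewrite setU11.
Qed.

Lemma shortS I J : I \subset J -> short d J -> short d I.
Proof.
move=> IJ /(shortP d2 dn) sJ; apply/shortP => // i /(subsetP IJ)/sJ[-> h].
by split=> // j /(subsetP IJ)/h.
Qed.

(** Dropping indices from I one by one climbs strictly to the whole polytope, of rank d + 1. *)
Lemma rk_cap_le I : short d I -> (rk (hull (facet_cap d I)) + #|I| <= d.+1)%N.
Proof.
have [k kI] := ubnP #|I|; elim: k I kI => // k IH I kI sI.
have [->|[j jI]] := set_0Vmem I.
  by rewrite /facet_cap big_set0 cards0 addn0 rk_hullT.
have sI' := shortS (subD1set I j) sI.
have jI' : j \notin I :\ j by rewrite setD11.
have := @cap_proper (I :\ j) j sI'; rewrite setD1K // => /(_ sI jI').
move=> /(rk_proper (flat_cap _ _) (flat_cap _ _)) rI.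
have cI : #|I| = #|I :\ j|.+1 by rewrite (cardsD1 j I) jI.
rewrite cI addnS -addSn; apply: leq_trans (IH _ _ sI'); last by rewrite -cI.
by rewrite leq_add2r.
Qed.

(** Adding indices to I descends strictly until I has d - 1 elements, where the face still properly
    contains a vertex. *)
Lemma rk_cap_ge I : short d I -> (d.+1 <= rk (hull (facet_cap d I)) + #|I|)%N.
Proof.
move=> sI; have [k] := ubnP (d - #|I|); elim: k I sI => // k IH I sI kI.
have [p0 [p1 [p01 p1n Ip _ capE]]] := short_interval d2 dn sI.
have [cI|cI] := ltnP #|I| d.-1; last first.
  have [j j0] : exists j : 'I_n.+1, j = p0 :> nat.
    by exists (inord p0); rewrite inordK //; lia.
  have := @rk_proper [set j] (facet_cap d I) (simp_flat d2 dn (simp1 d j)) (flat_cap _ _).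
  rewrite rk_simp ?simp1 // cards1 => h; have {h} : (1 < rk (hull (facet_cap d I)))%N.
    apply: h; rewrite properEcard sub1set cards1; apply/andP; split.
      by rewrite capE; apply/andP; split; [lia|apply/negP => /Ip; lia].
    have [_ ->] := card_cap d2 dn p01 p1n Ip capE.
    by have := short_card d2 dn sI; lia.
  lia.
(* There are d - 1 indices strictly between p0 and p0 + d, too many for I; a free one can be added
   keeping I short. *)
have [i [ip iI]] : exists i : 'I_n.+1, (p0 < i < p0 + d)%N /\ i \notin I.
  have : ~~ (segment n p0.+1 (p0 + d - 1) \subset I).
    apply/negP => /subset_leq_card; rewrite card_segment //; lia.
  by move=> /subsetPn[i]; rewrite inE => ip iI; exists i; split=> //; lia.
have siI : short d (i |: I).
  have /(shortP d2 dn) sI' := sI.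
  apply/shortP => // k'; rewrite in_setU1 => /orP[/eqP ->|kI'].
    split; first by rewrite /inner; have := ltn_ord i; lia.
    move=> j; rewrite in_setU1 => /orP[/eqP ->|/Ip]; lia.
  have [-> h] := sI' k' kI'; split=> // j.
  by rewrite in_setU1 => /orP[/eqP ->|/h //]; have := Ip _ kI'; lia.
have rI := rk_proper (flat_cap _ _) (flat_cap _ _) (cap_proper sI siI iI).
have cU : #|i |: I| = #|I|.+1 by rewrite cardsU1 iI.
apply: (leq_trans (IH _ siI _)); last by rewrite cU addnS -addSn leq_add2r.
by rewrite cU; move: cI kI; set c := #|I|; lia.
Qed.

Lemma rk_flat K : flat K -> rk (hull K) = rank K.
Proof.
move=> fK; have [sK|[I sI ->]] := flat_cases d2 dn fK.
  by rewrite rk_simp // rank_simp.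
by rewrite rank_cap //; have := rk_cap_le sI; have := rk_cap_ge sI; lia.
Qed.

Lemma rank_card K : flat K -> (rank K <= #|K|)%N.
Proof. by move=> /rk_flat <-; exact: rk_hull_card. Qed.

Lemma toric_h_ofE (g : set 'rV[R]_m -> {poly int}) J : flat J ->
  toric_h_of g (hull J) = \sum_(K : {set 'I_n.+1} | flat K && (K \proper J))
    g (hull K) * ('X - 1) ^+ ((rank J).-1 - rank K).
Proof.
move=> fJ; rewrite /toric_h_of.
pose B := [set K | flat K && (K \proper J)]%SET.
have -> : proper_faces (hull J) = hull @` [set` B].
  apply/seteqP; split=> F.
    move=> [/(face_flat F fJ)[K [fK KJ ->]] /= KJ']; exists K => //=.
    rewrite inE fK properEneq KJ andbT; apply/eqP => E.
    by apply: KJ'; rewrite E.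
  move=> [K]; rewrite /= inE => /andP[fK KJ] <-; split.
    by apply/face_flat => //; exists K; rewrite proper_sub.
  by move=> /h_inj E; move: KJ; rewrite E properxx.
rewrite fsbig_image; last by move=> K L _ _; exact: h_inj.
rewrite fsbig_finite ?finite_finset // fset_set_finset big_imfset //= big_enum.
rewrite -(eq_bigl _ _ (fun K => in_set (fun K => flat K && (K \proper J)) K)).
by apply: eq_bigr => K; rewrite inE => /andP[fK _]; rewrite !rk_flat.
Qed.

(** The excess of vertices over a simplex of the same dimension; on flats the truncated subtraction
    is exact by [rank_card]. *)
Definition gap K : int := (#|K| - rank K)%:R.

(** This is [sum_flats] at y = X - 1 with the term K = J split off; the factor X - 1 pulled out of
    the rest accounts for the predecessor in the exponents of [toric_h_of]. *)
Lemma toric_h_gap J : flat J -> (0 < rank J)%N ->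
    (forall K, flat K -> K \proper J -> toric_g (hull K) = 1 + gap K *: 'X) ->
  ('X - 1) * toric_h (hull J) + (1 + gap J *: 'X) =
    'X^(rank J) + gap J *: 'X^((rank J).-1) :> {poly int}.
Proof.
move=> fJ rJ IH.
have natZ (k : nat) (p : {poly int}) : k%:R * p = (k%:R : int) *: p.
  by rewrite -mul_polyC rmorph_nat.
have := sum_flats d2 dn ('X - 1 : {poly int}) fJ.
rewrite subrK (bigD1 J) /= ?fJ ?subxx // subnn mulr1 addrC !natZ => <-.
rewrite /toric_h toric_h_ofE // mulr_sumr; congr (_ + _).
apply: eq_big => [K|K /andP[fK KJ]].
  by rewrite -andbA properEneq [(_ != _) && _]andbC.
have rK : (rank K < rank J)%N by rewrite -!rk_flat //; exact: rk_proper.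
rewrite IH // natZ mulrCA -exprS; congr (_ * _ ^+ _).
by lia.
Qed.

Lemma toric_g_gap J : flat J -> toric_g (hull J) = 1 + gap J *: 'X.
Proof.
have [k] := ubnP (rank J); elim: k J => // k IH J kJ fJ.
have gap0 : (rank J <= 2)%N -> gap J = 0.
  by move=> r2; rewrite /gap (rank_le2 d2 dn fJ r2) subnn.
rewrite toric_gE rk_flat //; case: eqP => [r0|/eqP r0].
  by rewrite gap0 ?r0 // scale0r addr0.
have rJ : (0 < rank J)%N by rewrite lt0n.
have [] // := @toric_g_of_linear (rank J) (gap J) (toric_h (hull J)).
apply: toric_h_gap => // K fK KJ; apply: IH => //.
have : (rank K < rank J)%N by rewrite -!rk_flat //; exact: rk_proper.
by move=> /leq_trans; apply; rewrite -ltnS.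
Qed.

Lemma multiplex_h12 : (2 < d)%N ->
  (toric_h (hull setT))`_1 = (toric_h (hull setT))`_2.
Proof.
move=> d3; have fT := flatT d n; have rT := rankT d2 dn.
have rT0 : (0 < rank [set: 'I_n.+1])%N by rewrite rT.
have E := toric_h_gap fT rT0 (fun K fK _ => toric_g_gap fK).
have rT2 : (rank [set: 'I_n.+1] <= 2)%N -> gap [set: 'I_n.+1] = 0.
  by rewrite rT => d1; exfalso; lia.
have [h _] := toric_g_of_linear rT0 rT2 E.
by rewrite !h ?rT.
Qed.

Lemma faces_of_dim_hull i : faces_of_dim i (hull setT) =
  hull @` [set` [set K : {set 'I_n.+1} | flat K && (rank K == i.+1)]%SET].
Proof.
apply/seteqP; split=> F.
  move=> [/(face_flat F (flatT d n))[K [fK _ ->]] rK]; exists K => //=.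
  by rewrite inE fK -rk_flat // rK /=.
move=> [K]; rewrite /= inE => /andP[fK /eqP rK] <-; split.
  by apply/face_flat; [exact: flatT | exists K; rewrite subsetT].
by rewrite rk_flat.
Qed.

Lemma fnum_hull i :
  fnum i (hull setT) = #|[set K : {set 'I_n.+1} | flat K && (rank K == i.+1)]%SET|.
Proof.
rewrite /fnum faces_of_dim_hull card_fset_set_image //.
by move=> K L _ _; exact: h_inj.
Qed.

Lemma fnum0_hull : fnum 0 (hull setT) = n.+1.
Proof.
rewrite fnum_hull -[RHS]card_ord -[in RHS]cardsT -[RHS](card_imset _ (@set1_inj _)).
apply: eq_card => K; rewrite inE; apply/andP/imsetP => [[fK /eqP rK]|[j _ ->]].
  have /eqP/cards1P[j ->] : #|K| = 1%N by rewrite -(rank_le2 d2 dn fK) rK.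
  by exists j.
by rewrite simp_flat ?rank_simp ?simp1 // cards1.
Qed.

Lemma fnum02_hull : vertices (hull setT) = range x ->
  fnum02 (hull setT) = (\sum_(K : {set 'I_n.+1} | flat K && (rank K == 3)) #|K|)%N.
Proof.
move=> vE; pose B := [set Kj : {set 'I_n.+1} * 'I_n.+1 |
  flat Kj.1 && (rank Kj.1 == 3) && (Kj.2 \in Kj.1)]%SET.
rewrite /fnum02.
have -> : [set vF : 'rV[R]_m * set 'rV[R]_m | [/\ vertices (hull setT) vF.1,
    faces_of_dim 2 (hull setT) vF.2 & vF.2 vF.1]] =
    (fun Kj => (x Kj.2, hull Kj.1)) @` [set` B].
  apply/seteqP; split=> [[v F]|_ [[K j] KB <-]].
    rewrite /= vE faces_of_dim_hull => -[[j _ <-] [K KB <-]].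
    move=> /(hull_mem x_inj x_vertex) jK; move: KB => /=.
    rewrite inE => /andP[fK rK].
    by exists (K, j) => //=; rewrite inE /= fK rK jK.
  move: KB; rewrite /= inE /= => /andP[/andP[fK rK] jK]; split; first by rewrite vE; exists j.
    by rewrite faces_of_dim_hull; exists K => //=; rewrite inE fK rK.
  exact: mem_hull.
rewrite card_fset_set_image; last first.
  by move=> [K j] [L k] _ _ /= [/x_inj -> /h_inj ->].
under [RHS]eq_bigr do rewrite -sum1_card.
by rewrite pair_big_dep /= sum1dep_card.
Qed.

Lemma coef_Xadd1 (N k : nat) : (('X + 1 : {poly int}) ^+ N)`_k = ('C(N, k))%:R.
Proof.
rewrite addrC exprDn coef_sum.
rewrite (eq_bigr (fun i : 'I_N.+1 => (k == i)%:R * ('C(N, k))%:R)) => [|i _]; last first.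
  rewrite expr1n mul1r coefMn coefXn.
  by case: eqP => [->|_]; rewrite ?mul1r ?mul0r ?mul0rn.
rewrite -mulr_suml; have [kN|kN] := leqP k N.
  rewrite (bigD1 (Ordinal (kN : (k < N.+1)%N))) //= eqxx big1 ?addr0 ?mul1r // => i.
  by rewrite -val_eqE /= eq_sym => /negPf ->.
by rewrite bin_small // mulr0.
Qed.

(** The coefficient of y^(d-1) in [sum_flats] for the whole polytope. A face of rank r and gap g
    contributes the coefficient of y^(r-2) in (1 + g) + g y: 1 for an edge, whose gap is 0, and g
    for a 2-face. *)
Lemma flag_sum :
  \sum_(K : {set 'I_n.+1} | flat K) ((rank K == 2)%:R + (rank K == 3)%:R * (#|K|%:Z - 3)) =
    ('C(d.+1, 2))%:Z + (n - d)%:Z * d%:Z.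
Proof.
have b1 : 'C(d.+1, d - 1) = 'C(d.+1, 2).
  by rewrite -bin_sub; [congr 'C(_, _); clear -d2; lia|clear -d2; lia].
have b2 : 'C(d, d - 1) = d.
  by rewrite -[RHS]bin1 -[RHS]bin_sub //; clear -d2; lia.
have := sum_flats d2 dn ('X : {poly int}) (flatT d n).
rewrite rankT // cardsT card_ord subSS => /(congr1 (fun p : {poly int} => p`_(d - 1))).
rewrite coef_sum coefD -polyC_natr coefCM !coef_Xadd1.
rewrite [_.-1]/= b1 b2 !natz => <-; apply: eq_big => [K|K fK]; first by rewrite subsetT andbT.
have rd : (rank K <= d.+1)%N.
  by rewrite -(rankT d2 dn); apply: rank_mono; rewrite ?flatT ?subsetT.
rewrite coefMXn -polyC_natr coefD coefCM coefD coefX coef1.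
have rK := rank_card fK.
(* Faces of rank below 2 carry a factor y^d or higher and contribute nothing. *)
case: ltnP => rK2.
  have [/negPf -> /negPf ->] : rank K != 2%N /\ rank K != 3%N by move: rd rK2; lia.
  by rewrite mul0r addr0.
rewrite (_ : (d - 1 - (d.+1 - rank K) == 0) = (rank K == 2))%N; last by lia.
rewrite (_ : (d - 1 - (d.+1 - rank K) == 1) = (rank K == 3))%N; last by lia.
have [r2|_] := eqVneq (rank K) 2%N.
  by rewrite -(rank_le2 d2 dn fK) r2 // subnn !mul0r mul1r !addr0 mul0r addr0.
have [r3|_] := eqVneq (rank K) 3%N; last by rewrite !mul0r addr0 mulr0.
rewrite !mul1r !add0r !addr0 mulr1 -r3 natz; lia.
Qed.

Lemma multiplex_flag : vertices (hull setT) = range x -> flag_relation (hull setT).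
Proof.
move=> vE; rewrite /flag_relation rk_hullT /= fnum0_hull fnum02_hull // !fnum_hull.
have := flag_sum; rewrite big_split /=.
have -> : \sum_(K : {set 'I_n.+1} | flat K) (rank K == 2)%:R =
    #|[set K : {set 'I_n.+1} | flat K && (rank K == 2)]%SET|%:Z.
  by rewrite -sum1dep_card -natz natr_sum big_mkcondr; apply: eq_bigr => K _; case: eqP.
have -> : \sum_(K : {set 'I_n.+1} | flat K) (rank K == 3)%:R * (#|K|%:Z - 3) =
    (\sum_(K : {set 'I_n.+1} | flat K && (rank K == 3)) #|K|)%N%:Z -
    3 * #|[set K : {set 'I_n.+1} | flat K && (rank K == 3)]%SET|%:Z.
  rewrite -sum1dep_card -!natz !natr_sum mulr_sumr -sumrB [RHS]big_mkcondr.
  by apply: eq_bigr => K _; case: eqP; rewrite ?mul0r // mul1r natz mulr1.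
(* That is, 2 C(d + 1, 2) = d (d + 1), which rewrites C(d + 1, 2) + (n - d) d as d (n + 1) - C(d +
   1, 2). *)
have := mul_bin_diag d.+1 1; rewrite bin1.
set f1 := #|_|; set f2 := #|_|; set s := (\sum_(K | _) _)%N; set c := 'C(_, 2).
by move: c f1 f2 s; clear -dn => c f1 f2 s; nia.
Qed.

End Multiplex.

(** As d is at least 2, the index range around 0 contains -1, and the one around n contains n + 1;
    these clamp to 0 and n, which puts x_0 and x_n on their own facets. *)
Lemma multiplex_facetE (R : realType) (m d n : nat) (x : 'I_n.+1 -> 'rV[R]_m)
    (i : 'I_n.+1) : (2 <= d)%N ->
  multiplex_facet d x i = hull x (facet_set d i).
Proof.
move=> d2; rewrite /multiplex_facet /hull; congr conv.
have clampE (k : 'I_n.+1) : clamp n (k%:Z) = k.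
  by apply: ord_inj; rewrite /= inordK; have := ltn_ord k; lia.
apply/seteqP; split=> _ [j jP <-]; move: jP => /=.
  move=> /andP[/andP[j1 j2] ji]; exists (clamp n j) => //=.
  have ni := ltn_ord i; rewrite inE /inner -val_eqE.
  by case: j j1 j2 ji => [k|k] /= j1 j2 ji; rewrite ?inordK; lia.
rewrite inE /inner -val_eqE /= => /and3P[ij ji jin].
have [jiE|jiN] := eqVneq (j : nat) i; last first.
  by exists j%:Z; rewrite ?clampE //=; lia.
move: jin; rewrite jiE eqxx /= => jin; have jn := ltn_ord j.
have [i0|i0] := posnP i.
  exists (-1); first by rewrite /=; lia.
  by congr x; apply: ord_inj; rewrite /= jiE.
exists n.+1%:Z; first by rewrite /=; lia.
by congr x; apply: ord_inj; rewrite /= inordK; lia.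
Qed.

Theorem corollary2p3 (R : realType) (m d n : nat) (x : 'I_n.+1 -> 'rV[R]_m)
    (P : set 'rV[R]_m) :
  (2 <= d)%N -> (d <= n)%N -> multiplex d x P -> elementary P.
Proof.
move=> d2 dn [polP rkP x_inj vE fE].
have PE : P = hull x setT.
  by have [_ _ ->] := polytope_vertices polP; rewrite vE hull_setT.
have x_vertex j : face (hull x setT) [set x j].
  by have : vertices P (x j); [rewrite vE; exists j|rewrite PE].
have facetsE : facets (hull x setT) = range (hull x \o @facet_set d n).
  rewrite -PE fE; apply/seteqP; split=> _ [i _ <-];
    by exists i; rewrite //= multiplex_facetE.
rewrite PE in rkP vE *; rewrite /elementary rkP; split.
  exact: multiplex_h12 x_inj x_vertex facetsE rkP.
exact: multiplex_flag x_inj x_vertex facetsE rkP vE.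
Qed.
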